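(* Each of the categories $\mathbf{\Sigma}_{\mathrm w},\mathbf{\Sigma}_{\mathrm s},\mathbf{\Sigma}_{\mathrm{ft}},\mathbf{\Sigma}_{\mathrm g}$ is symmetric monoidal closed using the tensor product (of that category) as its monoidal product. The left adjoint functors of the full embeddings $\mathbf{\Sigma}_{\mathrm s}\hookrightarrow\mathbf{\Sigma}_{\mathrm w}$, $\mathbf{\Sigma}_{\mathrm g}\hookrightarrow\mathbf{\Sigma}_{\mathrm{ft}}$, $\mathbf{\Sigma}_{\mathrm{ft}}\hookrightarrow\mathbf{\Sigma}_{\mathrm w}$ are strong symmetric monoidal.
   Context: Families. Fix an infinite set $\mathcal I$. A family of elements of a set $X$ is an indexed multiset $\{x_i\}_{i\in I}$ with $x_i\in X$ and $I\subseteq\mathcal I$ countable (finite and empty allowed); two families $\{x_i\}_I,\{y_j\}_J$ are identified if there is a bijection $\phi\colon I\to J$ with $x_i=y_{\phi(i)}$ for all $i$. $X^*$ is the set of all families; bold letters denote families. The disjoint union $\uplus_J\mathbf x_j$ of families is indexed by the disjoint union of the index sets. A subfamily is the restriction of a family to a subset of its index set. For $f\colon X\to Y$ and $\mathbf x=\{x_i\}_I$, $f\mathbf x=\{f(x_i)\}_I$. For a partial function $\Sigma\colon X^*\rightharpoonup X$, ''$\Sigma\mathbf x\simeq x$'' means $\Sigma\mathbf x$ is defined and equals $x$; $\mathbf x$ is summable if $\Sigma\mathbf x$ is defined. A weak $\Sigma$-monoid is a set $X$ with a partial function $\Sigma\colon X^*\rightharpoonup X$ such that: (Singleton) $\Sigma\{x\}\simeq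 x$ for all $x\in X$; (Neutral element) there is $0\in X$ with $\Sigma\emptyset\simeq 0$, and if $\mathbf x$ is summable then so is its subfamily $\mathbf x_\emptyset$ of elements other than $0$; (Bracketing) if $\{\mathbf x_j\}_J$ ($J$ countable) is an indexed set of finite summable families and $\mathbf x=\uplus_J\mathbf x_j$, then $\Sigma\mathbf x\simeq x$ implies $\Sigma\{\Sigma\mathbf x_j\}_J\simeq x$; (Flattening) if $\{\mathbf x_j\}_J$ is a finite indexed set of (possibly infinite) summable families and $\mathbf x=\uplus_J\mathbf x_j$, then $\Sigma\{\Sigma\mathbf x_j\}_J\simeq x$ implies $\Sigma\mathbf x\simeq x$. A $\Sigma$-homomorphism $f\colon(X,\Sigma)\to(Y,\Sigma')$ is a function such that $\Sigma\mathbf x\simeq x$ implies $\Sigma' f\mathbf x\simeq f(x)$, for all $\mathbf x\in X^*$, $x\in X$. A strong $\Sigma$-monoid is a weak $\Sigma$-monoid in which every subfamily of a summable family is summable, and in which, for every (countably) indexed set $\{\mathbf x_j\}_J$ of summable families with $\mathbf x=\uplus_J\mathbf x_j$ (no finiteness required), $\Sigma\mathbf x\simeq x$ implies $\Sigma\{\Sigma\mathbf x_j\}_J\simeq x$, and $\Sigma\{\Sigma\mathbf x_j\}_J\simeq x$ implies $\Sigma\mathbf x\simeq x$. A finitely total $\Sigma$-monoid is a weak $\Sigma$-monoid in which every finite family is summable. A $\Sigma$-group is a finitely total $\Sigma$-monoid such that for every $x$ there is $-x\in X$ with $\Sigma\{x,-x\}=0$ and $x\mapsto -x$ is a $\Sigma$-homomorphism.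 $\mathbf{\Sigma}_{\mathrm w}$ is the category of weak $\Sigma$-monoids and $\Sigma$-homomorphisms; $\mathbf{\Sigma}_{\mathrm s}$, $\mathbf{\Sigma}_{\mathrm{ft}}$, $\mathbf{\Sigma}_{\mathrm g}$ are its full subcategories of strong $\Sigma$-monoids, finitely total $\Sigma$-monoids and $\Sigma$-groups; $\mathbf{\Sigma}_*$ denotes any of the four. The embeddings $\mathbf{\Sigma}_{\mathrm s}\hookrightarrow\mathbf{\Sigma}_{\mathrm w}$, $\mathbf{\Sigma}_{\mathrm g}\hookrightarrow\mathbf{\Sigma}_{\mathrm{ft}}\hookrightarrow\mathbf{\Sigma}_{\mathrm w}$ have left adjoints. A function $f\colon X\times Y\to Z$ between objects of $\mathbf{\Sigma}_*$ is $\Sigma$-bilinear if $f(x,-)$ and $f(-,y)$ are $\Sigma$-homomorphisms for all $x\in X$, $y\in Y$. The tensor product of $X,Y$ in $\mathbf{\Sigma}_*$ is an object of $\mathbf{\Sigma}_*$ with a universal $\Sigma$-bilinear function from $X\times Y$: every $\Sigma$-bilinear function $X\times Y\to Z$ with $Z\in\mathbf{\Sigma}_*$ factors through it by a unique $\Sigma$-homomorphism. In $\mathbf{\Sigma}_{\mathrm w}$ it exists and is written $X\otimes Y$; for a subcategory $U\colon\mathbf{\Sigma}_*\hookrightarrow\mathbf{\Sigma}_{\mathrm w}$ with left adjoint $F$ it is $X\otimes' Y=F(UX\otimes UY)$. The monoidal unit of $\mathbf{\Sigma}_{\mathrm w}$ is $I=\{0,1\}$ with $\Sigma\{n_j\}_J=0$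 if no $n_j$ equals $1$, $=1$ if exactly one $n_j$ equals $1$, and undefined otherwise; the unit of $\mathbf{\Sigma}_*$ is $F(I)$. *)

(* Defs.v *)
From mathcomp Require Import all_boot boolp classical_sets functions cardinality.

Set Implicit Arguments.
Unset Strict Implicit.
Unset Printing Implicit Defensive.

Local Open Scope classical_set_scope.

Record ifamily (Idx X : Type) := IFamily {
  fidx : set Idx;
  fidx_countable : countable fidx;
  fval :> fidx -> X
}.

(* [{g t}_(t : T)], indexed by a type [T] rather than by a subset of [Idx],
   denotes the families [x] below, all of which are identified.  Disjoint unions
   and subfamilies are written in this way, with [T] a sigma-type. *)
Definition represents (Idx X T : Type) (g : T -> X) (x : ifamily Idx X) : Prop :=
  exists phi : T -> fidx x, bijective phi /\ forall t, x (phi t) = g t.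

Definition sums_to (Idx X : Type) (S : ifamily Idx X -> option X)
    (T : Type) (g : T -> X) (a : X) : Prop :=
  exists2 x, represents g x & S x = Some a.

Definition uplus (Idx X : Type) (J : set Idx) (xs : J -> ifamily Idx X) :
    {j : J & fidx (xs j)} -> X :=
  fun p => xs (projT1 p) (projT2 p).
Arguments uplus {Idx X J} xs _.

Definition fam_map (Idx X Y : Type) (f : X -> Y) (x : ifamily Idx X) :
    ifamily Idx Y :=
  IFamily (fidx_countable x) (fun i => f (x i)).

(* [Ssum_ident] makes [Ssum] a partial function on families up to bijective
   reindexing; the other fields are the axioms of a weak Sigma-monoid. *)
Record wmon (Idx : Type) := WMon {
  carrier :> Type;
  Ssum : ifamily Idx carrier -> option carrier;
  Ssum_ident : forall x y : ifamily Idx carrier,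
    represents x y -> Ssum x = Ssum y;
  Ssum_singleton : forall a : carrier, sums_to Ssum (fun _ : unit => a) a;
  Ssum_neutral : exists2 z : carrier, sums_to Ssum (@of_void carrier) z &
    forall (x : ifamily Idx carrier) a, Ssum x = Some a ->
    exists b, sums_to Ssum (fun i : {i : fidx x | x i <> z} => x (sval i)) b;
  Ssum_bracketing : forall (J : set Idx) (xs : J -> ifamily Idx carrier)
      (s : J -> carrier), countable J ->
    (forall j, finite_set (fidx (xs j))) ->
    (forall j, Ssum (xs j) = Some (s j)) ->
    forall a, sums_to Ssum (uplus xs) a -> sums_to Ssum s a;
  Ssum_flattening : forall (J : set Idx) (xs : J -> ifamily Idx carrier)
      (s : J -> carrier), finite_set J ->
    (forall j, Ssum (xs j) = Some (s j)) ->
    forall a, sums_to Ssum s a -> sums_to Ssum (uplus xs) a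
}.

Definition is_zero (Idx : Type) (M : wmon Idx) (z : M) : Prop :=
  sums_to (@Ssum _ M) (@of_void M) z.

Definition is_shom (Idx : Type) (M N : wmon Idx) (f : M -> N) : Prop :=
  forall (x : ifamily Idx M) a,
    Ssum x = Some a -> Ssum (fam_map f x) = Some (f a).

(* The property cutting out the whole category of weak Sigma-monoids. *)
Definition is_weak (Idx : Type) (M : wmon Idx) : Prop := True.

Definition is_strong (Idx : Type) (M : wmon Idx) : Prop :=
  [/\ forall (x : ifamily Idx M) a (P : fidx x -> Prop), Ssum x = Some a ->
        exists b, sums_to (@Ssum _ M) (fun i : {i | P i} => x (sval i)) b,
      forall (J : set Idx) (xs : J -> ifamily Idx M) (s : J -> M),
        countable J -> (forall j, Ssum (xs j) = Some (s j)) ->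
        forall a, sums_to (@Ssum _ M) (uplus xs) a -> sums_to (@Ssum _ M) s a
    & forall (J : set Idx) (xs : J -> ifamily Idx M) (s : J -> M),
        countable J -> (forall j, Ssum (xs j) = Some (s j)) ->
        forall a, sums_to (@Ssum _ M) s a -> sums_to (@Ssum _ M) (uplus xs) a].

Definition is_ftotal (Idx : Type) (M : wmon Idx) : Prop :=
  forall x : ifamily Idx M, finite_set (fidx x) -> exists a, Ssum x = Some a.

Definition is_sgroup (Idx : Type) (M : wmon Idx) : Prop :=
  is_ftotal M /\
  exists2 neg : M -> M,
    forall a, exists2 z, is_zero z &
      sums_to (@Ssum _ M) (fun b : bool => if b then a else neg a) z
  & is_shom neg.

Lemma sgroup_ftotal (Idx : Type) (M : wmon Idx) : is_sgroup M -> is_ftotal M.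
Proof. by case. Qed.

Record category := Category {
  obj :> Type;
  hom : obj -> obj -> Type;
  idm : forall X, hom X X;
  cmp : forall X Y Z, hom Y Z -> hom X Y -> hom X Z;
  cmp1m : forall X Y (f : hom X Y), cmp (idm Y) f = f;
  cmpm1 : forall X Y (f : hom X Y), cmp f (idm X) = f;
  cmpA : forall W X Y Z (h : hom Y Z) (g : hom X Y) (f : hom W X),
    cmp h (cmp g f) = cmp (cmp h g) f
}.
Arguments hom {c} X Y.
Arguments idm {c} X.
Arguments cmp {c X Y Z} g f.

Declare Scope cat_scope.
Delimit Scope cat_scope with cat.
Local Open Scope cat_scope.
Notation "g ∘ f" := (cmp g f) (at level 40, left associativity) : cat_scope.

Definition is_iso (C : category) (X Y : C) (f : hom X Y) : Prop :=
  exists g : hom Y X, g ∘ f = idm X /\ f ∘ g = idm Y.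

Record functor (C D : category) := Functor {
  fob :> C -> D;
  fmap : forall X Y : C, hom X Y -> hom (fob X) (fob Y);
  fmap1 : forall X, fmap (idm X) = idm (fob X);
  fmapM : forall X Y Z (g : hom Y Z) (f : hom X Y),
    fmap (g ∘ f) = fmap g ∘ fmap f
}.
Arguments fmap {C D} f {X Y} _ : rename.

Record left_adjoint (C D : category) (U : functor D C) := LeftAdjoint {
  ladj :> functor C D;
  aunit : forall X : C, hom X (U (ladj X));
  acounit : forall A : D, hom (ladj (U A)) A;
  aunit_nat : forall X Y (f : hom X Y),
    aunit Y ∘ f = fmap U (fmap ladj f) ∘ aunit X;
  acounit_nat : forall A B (f : hom A B),
    f ∘ acounit A = acounit B ∘ fmap ladj (fmap U f);
  triangle_l : forall X, acounit (ladj X) ∘ fmap ladj (aunit X) = idm (ladj X);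
  triangle_r : forall A, fmap U (acounit A) ∘ aunit (U A) = idm (U A)
}.

(* Symmetric monoidal closed structures on [C] with prescribed action [ten] of
   the monoidal product on objects and prescribed unit [un]. *)
Record sym_monoidal_closed (C : category) (ten : C -> C -> C) (un : C) :=
  SymMonoidalClosed {
  tmap : forall X X' Y Y', hom X X' -> hom Y Y' -> hom (ten X Y) (ten X' Y');
  tmap1 : forall X Y, tmap (idm X) (idm Y) = idm (ten X Y);
  tmapM : forall X X' X'' Y Y' Y'' (f' : hom X' X'') (f : hom X X')
      (g' : hom Y' Y'') (g : hom Y Y'),
    tmap (f' ∘ f) (g' ∘ g) = tmap f' g' ∘ tmap f g;

  assoc : forall X Y Z, hom (ten (ten X Y) Z) (ten X (ten Y Z));
  lunit : forall X, hom (ten un X) X;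
  runit : forall X, hom (ten X un) X;
  braid : forall X Y, hom (ten X Y) (ten Y X);

  assoc_iso : forall X Y Z, is_iso (assoc X Y Z);
  lunit_iso : forall X, is_iso (lunit X);
  runit_iso : forall X, is_iso (runit X);

  assoc_nat : forall X X' Y Y' Z Z'
      (f : hom X X') (g : hom Y Y') (h : hom Z Z'),
    assoc X' Y' Z' ∘ tmap (tmap f g) h = tmap f (tmap g h) ∘ assoc X Y Z;
  lunit_nat : forall X X' (f : hom X X'),
    lunit X' ∘ tmap (idm un) f = f ∘ lunit X;
  runit_nat : forall X X' (f : hom X X'),
    runit X' ∘ tmap f (idm un) = f ∘ runit X;
  braid_nat : forall X X' Y Y' (f : hom X X') (g : hom Y Y'),
    braid X' Y' ∘ tmap f g = tmap g f ∘ braid X Y;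

  pentagon : forall W X Y Z,
    assoc W X (ten Y Z) ∘ assoc (ten W X) Y Z
    = tmap (idm W) (assoc X Y Z) ∘ assoc W (ten X Y) Z
      ∘ tmap (assoc W X Y) (idm Z);
  triangle : forall X Y,
    tmap (idm X) (lunit Y) ∘ assoc X un Y = tmap (runit X) (idm Y);
  hexagon : forall X Y Z,
    assoc Y Z X ∘ braid X (ten Y Z) ∘ assoc X Y Z
    = tmap (idm Y) (braid X Z) ∘ assoc Y X Z ∘ tmap (braid X Y) (idm Z);
  braidK : forall X Y, braid Y X ∘ braid X Y = idm (ten X Y);

  ihom : C -> C -> C;
  eval : forall Y Z, hom (ten (ihom Y Z) Y) Z;
  eval_univ : forall X Y Z (f : hom (ten X Y) Z),
    exists! g : hom X (ihom Y Z), eval Y Z ∘ tmap g (idm Y) = f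
}.

Record strong_sym_monoidal (C D : category)
    (tenC : C -> C -> C) (unC : C) (MC : sym_monoidal_closed tenC unC)
    (tenD : D -> D -> D) (unD : D) (MD : sym_monoidal_closed tenD unD)
    (F : functor C D) := StrongSymMonoidal {
  smu : forall X Y, hom (tenD (F X) (F Y)) (F (tenC X Y));
  seps : hom unD (F unC);
  smu_iso : forall X Y, is_iso (smu X Y);
  seps_iso : is_iso seps;
  smu_nat : forall X X' Y Y' (f : hom X X') (g : hom Y Y'),
    smu X' Y' ∘ tmap MD (fmap F f) (fmap F g) = fmap F (tmap MC f g) ∘ smu X Y;
  smu_assoc : forall X Y Z,
    fmap F (assoc MC X Y Z) ∘ smu (tenC X Y) Z ∘ tmap MD (smu X Y) (idm (F Z))
    = smu X (tenC Y Z) ∘ tmap MD (idm (F X)) (smu Y Z)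
      ∘ assoc MD (F X) (F Y) (F Z);
  smu_lunit : forall X,
    fmap F (lunit MC X) ∘ smu unC X ∘ tmap MD seps (idm (F X))
    = lunit MD (F X);
  smu_runit : forall X,
    fmap F (runit MC X) ∘ smu X unC ∘ tmap MD (idm (F X)) seps
    = runit MD (F X);
  smu_braid : forall X Y,
    fmap F (braid MC X Y) ∘ smu X Y = smu Y X ∘ braid MD (F X) (F Y)
}.

Record sobj (Idx : Type) (P : wmon Idx -> Prop) := SObj {
  sobj_mon :> wmon Idx;
  sobj_prop : P sobj_mon
}.

Record shom (Idx : Type) (M N : wmon Idx) := SHom {
  shom_fun :> M -> N;
  shomP : is_shom shom_fun
}.

Lemma shom_ext (Idx : Type) (M N : wmon Idx) (f g : shom M N) :
  (forall a, f a = g a) -> f = g.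
Proof.
case: f g => f fP [g gP] /= fg.
have e : f = g by apply/funext.
by case: _ / e gP => gP; rewrite (Prop_irrelevance fP gP).
Qed.

Lemma is_shom_id (Idx : Type) (M : wmon Idx) : is_shom (fun a : M => a).
Proof. by move=> [I cI x] a. Qed.

Lemma is_shom_comp (Idx : Type) (L M N : wmon Idx)
    (g : shom M N) (f : shom L M) : is_shom (fun a => g (f a)).
Proof. by move=> x a /(shomP f)/(shomP g). Qed.

Definition shom_id (Idx : Type) (M : wmon Idx) : shom M M :=
  SHom (@is_shom_id Idx M).
Definition shom_comp (Idx : Type) (L M N : wmon Idx)
    (g : shom M N) (f : shom L M) : shom L N :=
  SHom (is_shom_comp g f).

Definition sigma_cat (Idx : Type) (P : wmon Idx -> Prop) : category.
Proof.
refine (@Category (sobj P) (fun M N => shom M N)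
  (fun M => shom_id M) (fun L M N g f => shom_comp g f) _ _ _).
- abstract by move=> X Y f; apply: shom_ext.
- abstract by move=> X Y f; apply: shom_ext.
- abstract by move=> W X Y Z h g f; apply: shom_ext.
Defined.

Definition sigma_incl (Idx : Type) (P Q : wmon Idx -> Prop)
    (PQ : forall M, P M -> Q M) : functor (sigma_cat P) (sigma_cat Q) :=
  @Functor (sigma_cat P) (sigma_cat Q)
    (fun M => SObj (PQ _ (sobj_prop M))) (fun M N f => f)
    (fun=> erefl) (fun _ _ _ _ _ => erefl).

Definition Sw (Idx : Type) : category := sigma_cat (@is_weak Idx).
Definition Ss (Idx : Type) : category := sigma_cat (@is_strong Idx).
Definition Sft (Idx : Type) : category := sigma_cat (@is_ftotal Idx).
Definition Sg (Idx : Type) : category := sigma_cat (@is_sgroup Idx).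

Definition Ss_Sw (Idx : Type) : functor (Ss Idx) (Sw Idx) :=
  @sigma_incl Idx (@is_strong Idx) (@is_weak Idx) (fun _ _ => I).
Definition Sft_Sw (Idx : Type) : functor (Sft Idx) (Sw Idx) :=
  @sigma_incl Idx (@is_ftotal Idx) (@is_weak Idx) (fun _ _ => I).
Definition Sg_Sft (Idx : Type) : functor (Sg Idx) (Sft Idx) :=
  @sigma_incl Idx (@is_sgroup Idx) (@is_ftotal Idx) (@sgroup_ftotal Idx).

Definition sbilinear (Idx : Type) (X Y Z : wmon Idx) (f : X -> Y -> Z) : Prop :=
  (forall x, is_shom (f x)) /\ (forall y, is_shom (f^~ y)).

Record tensor_products (Idx : Type) (P : wmon Idx -> Prop) := TensorProducts {
  tob :> sigma_cat P -> sigma_cat P -> sigma_cat P;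
  pure : forall X Y : sobj P, X -> Y -> (tob X Y : sobj P);
  pure_bilinear : forall X Y, sbilinear (@pure X Y);
  pure_univ : forall (X Y Z : sobj P) (f : X -> Y -> Z), sbilinear f ->
    exists! h : shom (tob X Y : sobj P) Z, forall x y, h (pure x y) = f x y
}.

(* The last fields say that the monoidal product acts on morphisms as the
   functor induced by the universal property, and that the structure
   isomorphisms are the canonical ones; [one] is the generator of the unit. *)
Record tensor_structure (Idx : Type) (P : wmon Idx -> Prop)
    (T : tensor_products P) (un : sigma_cat P) (one : (un : sobj P)) :=
  TensorStructure {
  tsmc :> @sym_monoidal_closed (sigma_cat P) T un;
  tmap_pure : forall (X X' Y Y' : sobj P) (f : shom X X') (g : shom Y Y')
      (x : X) (y : Y),
    (@tmap (sigma_cat P) T un tsmc X X' Y Y' f g : shom _ _) (pure T x y)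
    = pure T (f x) (g y);
  assoc_pure : forall (X Y Z : sobj P) (x : X) (y : Y) (z : Z),
    (assoc tsmc X Y Z : shom _ _) (pure T (pure T x y) z)
    = pure T x (pure T y z);
  lunit_pure : forall (X : sobj P) (x : X),
    (lunit tsmc X : shom _ _) (pure T one x) = x;
  runit_pure : forall (X : sobj P) (x : X),
    (runit tsmc X : shom _ _) (pure T x one) = x;
  braid_pure : forall (X Y : sobj P) (x : X) (y : Y),
    (braid tsmc X Y : shom _ _) (pure T x y) = pure T y x
}.
Arguments tensor_structure {Idx P} T un one.

Definition unit_sum (Idx : Type) (x : ifamily Idx bool) : option bool :=
  if `[< forall i, x i = false >] then Some false
  else if `[< exists! i, x i = true >] then Some true
  else None.

Definition unit_spec (T : Type) (g : T -> bool) (b : bool) : Prop :=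
  if b then exists! t, g t = true else forall t, g t = false.

Lemma unit_sumP (Idx : Type) (x : ifamily Idx bool) b :
  unit_sum x = Some b <-> unit_spec x b.
Proof.
rewrite /unit_sum /unit_spec; case: asboolP => [x0|nx0].
  by case: b; split=> // -[i [xi _]]; rewrite x0 in xi.
by case: asboolP => [x1|nx1]; case: b; split.
Qed.

Lemma unit_spec_bij (T T' : Type) (g : T -> bool) (g' : T' -> bool)
    (phi : T -> T') : bijective phi -> (forall t, g' (phi t) = g t) ->
  forall b, unit_spec g b <-> unit_spec g' b.
Proof.
move=> [psi pK qK] e [] /=; split.
- case=> t [gt u]; exists (phi t); split=> [|t' gt']; first by rewrite e.
  by rewrite (u (psi t')) ?qK// -e qK.
- case=> t [gt u]; exists (psi t); split=> [|t' gt']; first by rewrite -e qK.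
  by rewrite (u (phi t')) ?pK// e.
- by move=> g0 t; rewrite -(qK t) e.
- by move=> g0 t; rewrite -e.
Qed.

Lemma unit_sums_to (Idx T : Type) (g : T -> bool) b :
  sums_to (@unit_sum Idx) g b -> unit_spec g b.
Proof.
by move=> [x [phi [bij e]] /unit_sumP]; rewrite (unit_spec_bij bij e).
Qed.

Lemma represents_ex (Idx : Type) (infI : infinite_set [set: Idx])
    (X T : Type) (g : T -> X) : countable [set: T] ->
  exists x : ifamily Idx X, represents g x.
Proof.
move=> cT; have [h hinj] : exists h : T -> Idx, injective h.
  have /card_leP[f] : ([set: T] #<= [set: Idx])%card.
    by apply: card_le_trans cT _; apply/infiniteP.
  exists (fun t => sval (f (to_setT t))) => t t' /val_inj.
  by move=> /(@inj _ _ _ f _ _ (mem_set I) (mem_set I)) /(congr1 sval).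
have cR : countable (range h).
  by apply: sub_countable cT; exact: card_image_le.
have ex (i : range h) : exists t, h t = sval i.
  by case: i => i /= /set_mem[t _ <-]; exists t.
pose psi i := sval (cid (ex i)).
have psiP i : h (psi i) = sval i by rewrite /psi; case: cid.
exists (IFamily cR (fun i => g (psi i))).
have hr t : h t \in range h by apply/mem_set; exists t.
exists (fun t => exist _ (h t) (hr t)).
have pK t : psi (exist _ (h t) (hr t)) = t by apply: hinj; rewrite psiP.
split=> [|t] /=; last by rewrite pK.
by exists psi => [//|i]; apply: val_inj; rewrite /= psiP.
Qed.

Lemma unit_sums_toP (Idx : Type) (infI : infinite_set [set: Idx])
    (T : Type) (g : T -> bool) b : countable [set: T] ->
  unit_spec g b -> sums_to (@unit_sum Idx) g b.
Proof.
move=> /(represents_ex infI)-/(_ _ g)[x rx] gb; exists x => //.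
by apply/unit_sumP; case: rx => phi [bij e]; apply/(unit_spec_bij bij e).
Qed.

Lemma countable_uplus (Idx X : Type) (J : set Idx) (xs : J -> ifamily Idx X) :
  countable J -> countable [set: {j : J & fidx (xs j)}].
Proof.
have inj_nat (A : set Idx) : countable A -> exists f : A -> nat, injective f.
  rewrite -(eq_countable (card_setT _)) => /countable_injP[f fi].
  by exists f => a b; apply: fi; rewrite inE.
move=> /inj_nat[f fi]; apply/countable_injP.
pose h j := cid (inj_nat _ (fidx_countable (xs j))).
exists (fun p : {j : J & fidx (xs j)} =>
  choice.pickle (f (projT1 p), sval (h (projT1 p)) (projT2 p))).
move=> [j i] [j' i'] _ _ /(pcan_inj choice.pickleK)[/fi e].
by case: _ / e i' => i' /(svalP (h j)) ->.
Qed.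

Lemma unit_spec_bracketing (Idx : Type) (J : set Idx)
    (xs : J -> ifamily Idx bool) (s : J -> bool) :
  (forall j, unit_sum (xs j) = Some (s j)) ->
  forall a, unit_spec (uplus xs) a <-> unit_spec s a.
Proof.
move=> xss.
have xs0 j : s j = false -> forall i, xs j i = false.
  by move=> sj; have /unit_sumP := xss j; rewrite sj.
have xs1 j : s j = true -> exists! i, xs j i = true.
  by move=> sj; have /unit_sumP := xss j; rewrite sj.
have s1 j i : xs j i = true -> s j = true.
  by case E: (s j) => //; rewrite (xs0 _ E).
case=> /=; split.
- case=> -[j i] [xji u]; exists j; split=> [|j' /xs1[i' [xi' _]]].
    exact: s1 xji.
  by have /(congr1 (@projT1 _ _)) := u (existT _ j' i') xi'.
- case=> j [/xs1[i [xi ui]] u]; exists (existT _ j i); split=> // -[j' i'].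
  rewrite /uplus /= => xi'; have e := u j' (s1 _ _ xi').
  by case: _ / e i' xi' => i' /ui ->.
- move=> x0 j; case E: (s j) => //.
  by case: (xs1 _ E) => i [xi _]; have := x0 (existT _ j i); rewrite /uplus /= xi.
- by move=> s0 [j i]; apply: xs0.
Qed.

Lemma countable_sub (Idx X : Type) (x : ifamily Idx X) (P : fidx x -> Prop) :
  countable [set: {i | P i}].
Proof.
have := fidx_countable x; rewrite -(eq_countable (card_setT _)).
move=> /countable_injP[f fi]; apply/countable_injP; exists (fun i => f (sval i)).
move=> [i Pi] [i' Pi'] _ _ /= /(fi _ _ (mem_set I) (mem_set I)) e.
exact: eq_exist.
Qed.

Lemma unit_sum_ident (Idx : Type) (x y : ifamily Idx bool) :
  represents x y -> unit_sum x = unit_sum y.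
Proof.
move=> [phi [bij e]].
have xy b : unit_sum x = Some b <-> unit_sum y = Some b.
  by rewrite !unit_sumP; exact: (unit_spec_bij bij e).
case E: (unit_sum x) => [b|]; first by apply/esym/xy.
by case E': (unit_sum y) => [b|//]; move/xy: E'; rewrite E.
Qed.

Lemma unit_sum_singleton (Idx : Type) (infI : infinite_set [set: Idx]) a :
  sums_to (@unit_sum Idx) (fun _ : unit => a) a.
Proof.
apply: (unit_sums_toP infI); first exact: countableP.
by case: a => //=; exists tt; split=> // -[].
Qed.

Lemma unit_sum_neutral (Idx : Type) (infI : infinite_set [set: Idx]) :
  exists2 z, sums_to (@unit_sum Idx) (@of_void bool) z &
  forall (x : ifamily Idx bool) a, unit_sum x = Some a ->
  exists b,
    sums_to (@unit_sum Idx) (fun i : {i : fidx x | x i <> z} => x (sval i)) b.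
Proof.
exists false; first by apply: (unit_sums_toP infI) => [|[]]; exact: countableP.
move=> x a /unit_sumP xa; exists a; apply: (unit_sums_toP infI).
  exact: (@countable_sub _ _ x (fun i => x i <> false)).
case: a xa => /= [[i [xi u]]|x0 [i ?]]; last exact: x0.
have xn : x i <> false by rewrite xi.
by exists (exist _ i xn); split=> // -[i' ?] /= /u e; exact: eq_exist.
Qed.

Lemma unit_sum_bracketing (Idx : Type) (infI : infinite_set [set: Idx])
    (J : set Idx) (xs : J -> ifamily Idx bool) (s : J -> bool) : countable J ->
  (forall j, unit_sum (xs j) = Some (s j)) ->
  forall a, sums_to (@unit_sum Idx) (uplus xs) a ->
  sums_to (@unit_sum Idx) s a.
Proof.
move=> cJ xss a /unit_sums_to/(unit_spec_bracketing xss) sa.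
by apply: (unit_sums_toP infI) => //; rewrite (eq_countable (card_setT _)).
Qed.

Lemma unit_sum_flattening (Idx : Type) (infI : infinite_set [set: Idx])
    (J : set Idx) (xs : J -> ifamily Idx bool) (s : J -> bool) : finite_set J ->
  (forall j, unit_sum (xs j) = Some (s j)) ->
  forall a, sums_to (@unit_sum Idx) s a ->
  sums_to (@unit_sum Idx) (uplus xs) a.
Proof.
move=> /finite_set_countable cJ xss a /unit_sums_to sa.
apply: (unit_sums_toP infI); first exact: countable_uplus.
exact/(unit_spec_bracketing xss).
Qed.

Definition unit_wmon (Idx : Type) (infI : infinite_set [set: Idx]) : wmon Idx :=
  WMon (@unit_sum_ident Idx) (unit_sum_singleton infI) (unit_sum_neutral infI)
    (fun J xs s cJ _ => unit_sum_bracketing infI cJ)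
    (unit_sum_flattening infI).

Definition Sw_unit (Idx : Type) (infI : infinite_set [set: Idx]) : Sw Idx :=
  @SObj Idx (@is_weak Idx) (unit_wmon infI) I.

Definition Sw_one (Idx : Type) (infI : infinite_set [set: Idx]) :
  (Sw_unit infI : sobj (@is_weak Idx)) := true.

(* Main.v *)
(* A weak Sigma-monoid does not see zeros: empty families let bracketing insert
   them, so sums are unchanged when zeros are added or removed.  Hence for a set
   with a separating class of functions to Sigma-monoids and a common zero, the
   pointwise sums that have a value in the set form a weak Sigma-monoid.  Applied
   to Sigma-homomorphisms and evaluations this gives the internal hom, which
   inherits strength, finite totality and negation from its codomain.  Applied to
   a set closed under pointwise sums it gives free objects: inside the product of
   all models of some generators and relations, take what the generators reach by
   defined sums.  This yields the weak tensor product and the left adjoints, and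
   reflecting a tensor product of the larger category gives the smaller one.
   The coherence laws are then equations between homomorphisms that agree on pure
   tensors of generators; multilinear maps extend from generators one argument
   at a time, because the curried maps land in an internal hom. *)

Require Import Defs.
From mathcomp Require Import all_boot boolp classical_sets functions cardinality.

Set Implicit Arguments.
Unset Strict Implicit.
Unset Printing Implicit Defensive.

Local Open Scope classical_set_scope.

Local Notation sums M := (sums_to (@Ssum _ M)).

(** * Sums over arbitrary countable types *)

Section Sums.
Context {Idx : Type}.
Implicit Types (M N : wmon Idx).

Lemma represents_self X (x : ifamily Idx X) : represents x x.
Proof. by exists id; split=> //; exists id. Qed.

Lemma represents_bij X T T' (g : T -> X) (g' : T' -> X) (phi : T -> T')
    (x : ifamily Idx X) : bijective phi -> (forall t, g' (phi t) = g t) ->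
  represents g x <-> represents g' x.
Proof.
move=> [psi pK qK] e; split=> -[h [hb he]].
  exists (h \o psi); split; first by apply: bij_comp => //; exists phi.
  by move=> t /=; rewrite he -e qK.
exists (h \o phi); split; first by apply: bij_comp => //; exists psi.
by move=> t /=; rewrite he e.
Qed.

Lemma sums_bij M T T' (g : T -> M) (g' : T' -> M) (phi : T -> T') a :
  bijective phi -> (forall t, g' (phi t) = g t) -> sums M g a <-> sums M g' a.
Proof.
move=> b e; split=> -[x r xa]; exists x => //; move: r;
  by rewrite (represents_bij _ b e).
Qed.

Lemma sums_bij_imp M T T' (g : T -> M) (g' : T' -> M) (phi : T -> T') a :
  sums M g a -> bijective phi -> (forall t, g' (phi t) = g t) -> sums M g' a.
Proof. by move=> s b e; apply/(sums_bij a b e). Qed.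

Lemma sums_eq M T (g g' : T -> M) a : g =1 g' -> sums M g a -> sums M g' a.
Proof. by move=> /funext->. Qed.

Lemma represents_trans X T (g : T -> X) (x y : ifamily Idx X) :
  represents g x -> represents g y -> represents x y.
Proof. by move=> [phi [b e]] ry; apply/(represents_bij y b e). Qed.

Lemma SsumP M (x : ifamily Idx M) a : Ssum x = Some a <-> sums M x a.
Proof.
split=> [xa|[y /Ssum_ident->]//]; exists x => //; exact: represents_self.
Qed.

Lemma sums_fun M T (g : T -> M) a b : sums M g a -> sums M g b -> a = b.
Proof.
move=> [x rx xa] [y ry]; rewrite -(Ssum_ident (represents_trans rx ry)) xa.
by case.
Qed.

Lemma represents_map X Y (f : X -> Y) T (g : T -> X) (x : ifamily Idx X) :
  represents g x -> represents (f \o g) (fam_map f x).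
Proof. by move=> [phi [b e]]; exists phi; split=> // t /=; rewrite e. Qed.

Lemma shom_sums M N (f : M -> N) T (g : T -> M) a :
  is_shom f -> sums M g a -> sums N (f \o g) (f a).
Proof.
by move=> hf [x r /hf]; exists (fam_map f x) => //; exact: represents_map.
Qed.

Lemma countable_type (J : set Idx) : countable J -> countable [set: J].
Proof. by rewrite (eq_countable (card_setT _)). Qed.

Lemma countable_inj T T' (h : T -> T') :
  injective h -> countable [set: T'] -> countable [set: T].
Proof.
move=> hi /countable_injP[f fi]; apply/countable_injP; exists (f \o h).
by move=> s t _ _ /= /(fi _ _ (mem_set I) (mem_set I))/hi.
Qed.

Lemma finite_inj T T' (h : T -> T') :
  injective h -> finite_set [set: T'] -> finite_set [set: T].
Proof. by move=> hi; apply: (@finite_preimage _ _ setT h) => s t _ _ /hi. Qed.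

Lemma finite_type (J : set Idx) : finite_set J <-> finite_set [set: J].
Proof. by rewrite (eq_finite_set (card_setT J)). Qed.

Lemma represents_countable X T (g : T -> X) (x : ifamily Idx X) :
  represents g x -> countable [set: T].
Proof.
move=> [phi [[psi pK _] _]].
exact: countable_inj (can_inj pK) (countable_type (fidx_countable x)).
Qed.

Lemma sums_countable M T (g : T -> M) a : sums M g a -> countable [set: T].
Proof. by move=> [x /represents_countable]. Qed.

Lemma inj_surj_bij T T' (h : T -> T') :
  injective h -> (forall t', exists t, h t = t') -> bijective h.
Proof.
move=> hi /choice[k kP]; exists k => // t; exact: hi.
Qed.

(** By proof irrelevance the equality of first components is [erefl], whatever the index type. *)
Lemma existT_inj A (B : A -> Type) a (b b' : B a) :
  existT B a b = existT B a b' -> b = b'.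
Proof.
move=> e; have := projT2_eq e; rewrite /=.
by rewrite (Prop_irrelevance (projT1_eq e) erefl).
Qed.

(** The counterpart of [uplus] over types, so that a double sum can be written down without choosing
    subsets of [Idx]. *)
Definition dsum (X J : Type) (T : J -> Type) (g : forall j, T j -> X) :
  {j : J & T j} -> X := fun p => g (projT1 p) (projT2 p).

(** The axioms speak only of index sets inside [Idx]. This carries a double family over types to
    that form, and the four bracketing and flattening lemmas below rest on it. *)
Lemma dsum_reindex M (infI : infinite_set [set: Idx]) J (T : J -> Type)
    (g : forall j, T j -> M) (s : J -> M) :
    countable [set: J] -> (forall j, sums M (g j) (s j)) ->
  exists (J' : set Idx) (phi : J' -> J) (xs : J' -> ifamily Idx M),
  [/\ bijective phi, countable J',
      forall j, represents (g (phi j)) (xs j),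
      forall j, Ssum (xs j) = Some (s (phi j))
    & forall a, sums M (dsum g) a <-> sums M (uplus xs) a].
Proof.
move=> cJ gs; have [y [psi [[phi psiK phiK] _]]] := represents_ex infI s cJ.
have ex j : exists x, represents (g j) x /\ Ssum x = Some (s j).
  by have [x] := gs j; exists x.
have [xs xsP] := choice ex.
exists (fidx y), phi, (xs \o phi); split.
- by exists psi.
- exact: fidx_countable.
- by move=> j; have [] := xsP (phi j).
- by move=> j; have [] := xsP (phi j).
have exk j : exists k : fidx (xs j) -> T j,
    bijective k /\ forall i, g j (k i) = xs j i.
  have [[h [[k hK kK] e]] _] := xsP j; exists k; split; first by exists h.
  by move=> i; rewrite -e kK.
pose k j := sval (cid (exk j)).
have kP j : bijective (k j) /\ forall i, g j (k j i) = xs j i.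
  exact: svalP (cid (exk j)).
pose F (p : {j : fidx y & fidx ((xs \o phi) j)}) : {j & T j} :=
  existT _ (phi (projT1 p)) (k _ (projT2 p)).
have bF : bijective F.
  apply: inj_surj_bij => [[j i] [j' i']|[j t]].
    rewrite /F /= => e; have e1 := can_inj phiK (projT1_eq e).
    case: _ / e1 i' e => i' e; have [[l lK _] _] := kP (phi j).
    by rewrite (can_inj lK (existT_inj e)).
  have [[l lK kK] _] := kP (phi (psi j)).
  (* The fibre over [psi j] is [T (phi (psi j))]; the existential form lets [psiK] be rewritten
     where a transport would otherwise appear. *)
  have [t' e] : exists t' : T (phi (psi j)), existT T _ t' = existT T j t.
    by rewrite psiK; exists t.
  by exists (existT _ (psi j) (l t')); rewrite /F /= kK.
move=> a; symmetry; apply: (sums_bij a bF) => -[j i].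
by have [_] := kP (phi j); apply.
Qed.

Section Infinite.
Context (infI : infinite_set [set: Idx]).

Lemma sums_bracketing M J (T : J -> Type) (g : forall j, T j -> M) s a :
    countable [set: J] -> (forall j, finite_set [set: T j]) ->
    (forall j, sums M (g j) (s j)) ->
  sums M (dsum g) a -> sums M s a.
Proof.
move=> cJ fT gs.
have [J' [phi [xs [bphi cJ' rxs xss e]]]] := dsum_reindex infI cJ gs.
move=> /e/(@Ssum_bracketing _ M _ _ _ cJ' _ xss) => H.
apply/(sums_bij (g := s \o phi) a bphi) => //; apply: H => j.
have [h [[k _ kK] _]] := rxs j.
by apply/finite_type/(finite_inj (can_inj kK)).
Qed.

Lemma sums_flattening M J (T : J -> Type) (g : forall j, T j -> M) s a :
    finite_set [set: J] -> (forall j, sums M (g j) (s j)) ->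
  sums M s a -> sums M (dsum g) a.
Proof.
move=> fJ gs sa.
have [J' [phi [xs [bphi cJ' rxs xss e]]]] :=
  dsum_reindex infI (sums_countable sa) gs.
apply/e/(@Ssum_flattening _ M _ _ (s \o phi)) => //.
  by apply/finite_type; apply: finite_inj fJ; exact: bij_inj bphi.
by apply/(sums_bij (g' := s) a bphi).
Qed.

Lemma strong_bracketing M J (T : J -> Type) (g : forall j, T j -> M) s a :
    is_strong M -> countable [set: J] -> (forall j, sums M (g j) (s j)) ->
  sums M (dsum g) a -> sums M s a.
Proof.
move=> [_ br _] cJ gs.
have [J' [phi [xs [bphi cJ' rxs xss e]]]] := dsum_reindex infI cJ gs.
by move=> /e/(br _ _ _ cJ' xss) H; apply/(sums_bij (g := s \o phi) a bphi).
Qed.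

Lemma strong_flattening M J (T : J -> Type) (g : forall j, T j -> M) s a :
    is_strong M -> (forall j, sums M (g j) (s j)) ->
  sums M s a -> sums M (dsum g) a.
Proof.
move=> [_ _ fl] gs sa.
have [J' [phi [xs [bphi cJ' rxs xss e]]]] :=
  dsum_reindex infI (sums_countable sa) gs.
apply/e/(fl _ _ (s \o phi)) => //.
by apply/(sums_bij (g' := s) a bphi).
Qed.

Lemma sums_void M (z : M) T (g : T -> M) :
  is_zero z -> (T -> False) -> sums M g z.
Proof.
move=> z0 nT; apply: (sums_bij_imp z0 (phi := @of_void T)).
  by exists (fun t => False_rect _ (nT t)) => [[]|t]; case: (nT t).
by case.
Qed.

Lemma sums_unit M (a : M) T (g : T -> M) t0 :
  (forall t, t = t0) -> g t0 = a -> sums M g a.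
Proof.
move=> u e; apply: (sums_bij_imp (Ssum_singleton a) (phi := fun=> t0)) => //.
by exists (fun=> tt) => [[]|t] //; rewrite (u t).
Qed.

Lemma zero_unique M (z z' : M) : is_zero z -> is_zero z' -> z = z'.
Proof. exact: sums_fun. Qed.

Lemma zero_ex M : exists z : M, is_zero z.
Proof. by have [z] := Ssum_neutral M; exists z. Qed.

(** The axiom only promises some value [b] for the nonzero part; that it equals [a] follows once the
    zeros are put back. *)
Lemma sums_nonzero_in M (z : M) T (g : T -> M) a : is_zero z -> sums M g a ->
  exists b, sums M (fun t : {t | g t <> z} => g (sval t)) b.
Proof.
move=> z0 [x [phi [[psi phiK psiK] e]] xa]; have [z' z0'] := Ssum_neutral M.
have <- := zero_unique z0 z0'; move=> /(_ x a xa)[b xb]; exists b.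
have pf (i : {i | x i <> z}) : g (psi (sval i)) <> z.
  by rewrite -e psiK; exact: (svalP i).
pose h (i : {i | x i <> z}) : {t | g t <> z} := exist _ (psi (sval i)) (pf i).
apply: (sums_bij_imp xb (phi := h)); last by move=> i /=; rewrite -e psiK.
apply: inj_surj_bij.
  by move=> [i p] [i' p'] /(congr1 sval)/= /(can_inj psiK) q; exact: eq_exist.
move=> [t p]; have p' : x (phi t) <> z by rewrite e.
by exists (exist _ (phi t) p'); apply: eq_exist; rewrite /= phiK.
Qed.

(* The missing zeros are the sums of empty families, so bracketing
   inserts them. *)
Lemma sums_nonzero_out M (z : M) T (g : T -> M) a : is_zero z ->
    countable [set: T] -> sums M (fun t : {t | g t <> z} => g (sval t)) a ->
  sums M g a.
Proof.
move=> z0 cT ga.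
apply: (@sums_bracketing M T (fun t => {u : unit | g t <> z})
          (fun t _ => g t)) => //.
- move=> t; apply: (@finite_inj _ unit sval); last exact: finite_finset.
  by move=> [[] p] [[] q] _; exact: eq_exist.
- move=> t; have [gz|gz] := pselect (g t = z).
    by rewrite gz; apply: sums_void => // -[].
  apply: (@sums_unit _ _ _ _ (exist _ tt gz)) => // -[[] p].
  exact: eq_exist.
apply: (sums_bij_imp ga (phi := fun t : {t | g t <> z} =>
  existT (fun t => {u : unit | g t <> z})
    (sval t) (exist _ tt (svalP t)))) => //.
apply: inj_surj_bij.
  by move=> [t p] [t' p'] /projT1_eq/= q; exact: eq_exist.
move=> [t [[] p]]; exists (exist _ t p) => /=; congr existT; exact: eq_exist.
Qed.

(** Remove all zeros, then put back those that lie in [D]. Putting back all of them shows that the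
    value has not changed. *)
Lemma sums_drop_zeros M (z : M) T (g : T -> M) (D : T -> Prop) a :
    is_zero z -> (forall t, g t <> z -> D t) -> sums M g a ->
  sums M (fun t : {t | D t} => g (sval t)) a.
Proof.
move=> z0 gD ga; have [b gb] := sums_nonzero_in z0 ga.
have cT := sums_countable ga.
rewrite (sums_fun ga (sums_nonzero_out z0 cT gb)).
apply: (sums_nonzero_out z0).
  by apply: (countable_inj _ cT (h := sval)) => -[t p] [t' p'] /= q;
    exact: eq_exist.
pose h (t : {t | g t <> z}) : {t : {t | D t} | g (sval t) <> z} :=
  exist _ (exist _ (sval t) (gD _ (svalP t))) (svalP t).
apply: (sums_bij_imp gb (phi := h)) => //.
apply: inj_surj_bij.
  by move=> [t p] [t' p'] /(congr1 (sval \o sval))/= q; exact: eq_exist.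
move=> [[t d] p]; exists (exist _ t p); apply: eq_exist => /=; exact: eq_exist.
Qed.

Lemma sums_zeros M (z : M) T (g : T -> M) :
  is_zero z -> countable [set: T] -> (forall t, g t = z) -> sums M g z.
Proof.
move=> z0 cT gz; apply: (sums_nonzero_out z0) => //.
by apply: sums_void => // -[].
Qed.

End Infinite.
End Sums.

(** * Initial structures and internal homs *)

(** The negation clause of [is_sgroup] with the function as a parameter, so that two negations can
    be compared. *)
Definition is_neg (Idx : Type) (M : wmon Idx) (n : M -> M) : Prop :=
  (forall a, exists2 z, is_zero z &
     sums M (fun b : bool => if b then a else n a) z) /\ is_shom n.

Section Initial.
Context (Idx : Type) (infI : infinite_set [set: Idx]) (C : Type).
(** The codomain of a point varies: the evaluations of an internal hom share one codomain, while the
    points of a free object range over many models. *)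
Context (Pt : forall M : wmon Idx, (C -> M) -> Prop).
Context (sep : forall a b,
  (forall (M : wmon Idx) (e : C -> M), Pt e -> e a = e b) -> a = b).
Context (z : C).
Context (z0 : forall (M : wmon Idx) (e : C -> M), Pt e -> is_zero (e z)).

(** A family may be summable at every point and still have no sum here, when no element of [C] takes
    all those values. By [sep] at most one element does. *)
Definition psum (x : ifamily Idx C) (a : C) : Prop :=
  forall (M : wmon Idx) (e : C -> M), Pt e -> Ssum (fam_map e x) = Some (e a).

Definition init_sum (x : ifamily Idx C) : option C :=
  if pselect (exists a, psum x a) is left h then Some (sval (cid h)) else None.

Lemma init_sumP x a : init_sum x = Some a <-> psum x a.
Proof.
rewrite /init_sum; case: pselect => [h|nh]; last first.
  by split=> // xa; case: nh; exists a.
have xb := svalP (cid h); split=> [[<- //]|xa].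
congr Some; apply: sep => M e p; have := xb M e p.
by rewrite xa // => -[].
Qed.

(** Countability is a clause of its own because the second clause is vacuous when there are no
    points. *)
Lemma init_sums_to T (g : T -> C) a : sums_to init_sum g a <->
  countable [set: T] /\
  forall (M : wmon Idx) (e : C -> M), Pt e -> sums M (e \o g) (e a).
Proof.
split=> [[x gx /init_sumP xa]|[cT ga]].
  split; first exact: represents_countable gx.
  by move=> M e p; exists (fam_map e x); [exact: represents_map|exact: xa].
have [x gx] := represents_ex infI g cT; exists x => //; apply/init_sumP.
move=> M e p; have [y gy <-] := ga M e p; apply: Ssum_ident.
by apply: (represents_trans _ gy); exact: represents_map.
Qed.

Lemma init_ident (x y : ifamily Idx C) :
  represents x y -> init_sum x = init_sum y.
Proof.
move=> xy.
have H a : init_sum x = Some a <-> init_sum y = Some a.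
  rewrite !init_sumP; split=> + M e p; move=> /(_ M e p) <-.
    by apply/esym/Ssum_ident; exact: represents_map xy.
  by apply/Ssum_ident; exact: represents_map xy.
case E: (init_sum x) => [a|]; first exact/esym/H.
by case E': (init_sum y) => [a|//]; move/H: E'; rewrite E.
Qed.

Lemma init_singleton a : sums_to init_sum (fun _ : unit => a) a.
Proof.
apply/init_sums_to; split=> [|M e _]; first exact: countableP.
exact: Ssum_singleton.
Qed.

Lemma init_neutral : exists2 z, sums_to init_sum (@of_void C) z &
  forall (x : ifamily Idx C) a, init_sum x = Some a ->
  exists b, sums_to init_sum (fun i : {i : fidx x | x i <> z} => x (sval i)) b.
Proof.
exists z.
  apply/init_sums_to; split=> [|M e p]; first exact: countableP.
  by apply: sums_void; [exact: (z0 p)|case].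
move=> x a /init_sumP xa; exists a; apply/init_sums_to; split.
  exact: (@countable_sub _ _ x (fun i => x i <> z)).
move=> M e p; have /SsumP := xa M e p.
(* An entry other than [z] may still vanish at this point, so some zeros remain; what matters is
   that no nonzero value is removed. *)
apply: (@sums_drop_zeros _ infI M (e z) _ _ (fun i => x i <> z)).
  exact: z0.
by move=> i /= exi xi; apply: exi; rewrite xi.
Qed.

Lemma init_bracketing (J : set Idx) (xs : J -> ifamily Idx C) (s : J -> C) :
    countable J -> (forall j, finite_set (fidx (xs j))) ->
    (forall j, init_sum (xs j) = Some (s j)) ->
  forall a, sums_to init_sum (uplus xs) a -> sums_to init_sum s a.
Proof.
move=> cJ fx xss a /init_sums_to[_ xa]; apply/init_sums_to.
split=> [|M e p]; first exact: countable_type.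
apply: (@sums_bracketing _ infI M _ _ (fun j i => e (xs j i)) _ _
  (countable_type cJ) _ _ (xa M e p)).
- by move=> j; exact: (finite_type _).1 (fx j).
- by move=> j; apply/(SsumP (fam_map e (xs j))); move/init_sumP: (xss j); apply.
Qed.

Lemma init_flattening (J : set Idx) (xs : J -> ifamily Idx C) (s : J -> C) :
    finite_set J -> (forall j, init_sum (xs j) = Some (s j)) ->
  forall a, sums_to init_sum s a -> sums_to init_sum (uplus xs) a.
Proof.
move=> fJ xss a /init_sums_to[_ xa]; apply/init_sums_to.
split=> [|M e p]; first exact: countable_uplus (finite_set_countable fJ).
apply: (@sums_flattening _ infI M _ _ (fun j i => e (xs j i)) _ _ _ _
  (xa M e p)).
- exact: (finite_type _).1 fJ.
- by move=> j; apply/(SsumP (fam_map e (xs j))); move/init_sumP: (xss j); apply.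
Qed.

Definition init_wmon : wmon Idx :=
  WMon init_ident init_singleton init_neutral init_bracketing init_flattening.

Lemma init_point (M : wmon Idx) (e : C -> M) : Pt e -> @is_shom _ init_wmon M e.
Proof. by move=> p x a /init_sumP; apply. Qed.

Lemma init_ftotal :
    (forall x, finite_set (fidx x) -> exists a, psum x a) ->
  is_ftotal init_wmon.
Proof. by move=> H x /H[a xa]; exists a; apply/init_sumP. Qed.

(** Bracketing and flattening can be checked point by point, but the sum of a subfamily needs a
    common value in [C]; the second hypothesis supplies it. *)
Lemma init_strong :
    (forall (M : wmon Idx) (e : C -> M), Pt e -> is_strong M) ->
    (forall (x : ifamily Idx C) a (P : fidx x -> Prop), psum x a ->
      exists b, forall (M : wmon Idx) (e : C -> M), Pt e ->
        sums M (fun i : {i | P i} => e (x (sval i))) (e b)) ->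
  is_strong init_wmon.
Proof.
move=> sM H; split.
- move=> x a P /init_sumP/(H _ _ P)[b xb]; exists b; apply/init_sums_to.
  by split=> //; exact: (@countable_sub _ _ x P).
- move=> J xs s cJ xss a /init_sums_to[_ xa]; apply/init_sums_to.
  split=> [|M e p]; first exact: countable_type.
  apply: (@strong_bracketing _ infI M _ _ (fun j i => e (xs j i)) _ _
    (sM _ _ p) (countable_type cJ) _ (xa M e p)).
  by move=> j; apply/(SsumP (fam_map e (xs j))); move/init_sumP: (xss j); apply.
- move=> J xs s cJ xss a /init_sums_to[_ xa]; apply/init_sums_to.
  split=> [|M e p]; first exact: countable_uplus.
  apply: (@strong_flattening _ infI M _ _ (fun j i => e (xs j i)) _ _
    (sM _ _ p) _ (xa M e p)).
  by move=> j; apply/(SsumP (fam_map e (xs j))); move/init_sumP: (xss j); apply.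
Qed.

Lemma init_neg (n : C -> C) :
    (forall (M : wmon Idx) (e : C -> M), Pt e ->
      exists2 m : M -> M, is_neg m & forall c, e (n c) = m (e c)) ->
  @is_neg _ init_wmon n.
Proof.
move=> H; split.
  move=> a; exists z.
    apply/init_sums_to; split=> [|M e p]; first exact: countableP.
    by apply: sums_void; [exact: (z0 p)|case].
  apply/init_sums_to; split=> [|M e p]; first exact: countableP.
  have [m [mP _] em] := H M e p.
  have [z' z0' sz'] := mP (e a); rewrite (zero_unique (z0 p) z0').
  by apply: sums_eq sz' => -[] //=; rewrite em.
move=> x a /init_sumP xa; apply/init_sumP => M e p.
have [m [_ mh] em] := H M e p; rewrite em -(mh _ _ (xa M e p)).
by congr Ssum; congr IFamily; apply/funext => i /=; rewrite em.
Qed.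

End Initial.

Section InternalHom.
Context (Idx : Type) (infI : infinite_set [set: Idx]).
Implicit Types (M Y Z : wmon Idx).

Lemma zero_shom Y Z (z : Z) : is_zero z -> is_shom (fun _ : Y => z).
Proof.
move=> z0 x a _; apply/SsumP; apply: sums_zeros => //.
exact: countable_type (fidx_countable x).
Qed.

(* The double sum of [f t (x k)] is flattened along [t] and bracketed along
   [k]. *)
Lemma pointwise_sum_shom Y Z T (f : T -> shom Y Z) (b : Y -> Z) :
    is_strong Z \/ is_ftotal Z /\ finite_set [set: T] ->
    (forall y, sums Z (fun t => f t y) (b y)) ->
  is_shom b.
Proof.
move=> ZT fb x a xa; apply/SsumP.
have cx := countable_type (fidx_countable x).
have fx t : sums Z (fun k => f t (x k)) (f t a).
  exact/(SsumP (fam_map _ _))/(shomP (f t)).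
pose swap (p : {t : T & fidx x}) := existT (fun=> T) (projT2 p) (projT1 p).
have bswap : bijective swap.
  by exists (fun p : {k : fidx x & T} =>
    existT (fun=> fidx x) (projT2 p) (projT1 p)) => -[].
have sw : sums Z (dsum (fun (t : T) (k : fidx x) => f t (x k))) (b a) ->
    sums Z (dsum (fun (k : fidx x) (t : T) => f t (x k))) (b a).
  by move=> s; apply: (sums_bij_imp s bswap) => -[].
(* Strength justifies both moves directly. Otherwise finiteness of [T] serves twice: there are
   finitely many families to flatten, and the blocks to bracket are finite. *)
case: ZT => [sZ|[tZ fT]].
  apply: (strong_bracketing infI sZ cx (fun k => fb (x k))); apply: sw.
  exact: (strong_flattening infI sZ fx (fb a)).
apply: (sums_bracketing infI cx (fun=> fT) (fun k => fb (x k))); apply: sw.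
exact: (sums_flattening infI fT fx (fb a)).
Qed.

(** An inductive family, so that case analysis identifies the codomain [M] with [Z] and leaves no
    transport behind. *)
Variant eval_point Y Z : forall M, (shom Y Z -> M) -> Prop :=
  EvalPoint y : @eval_point Y Z Z (fun f => f y).

Lemma eval_point_sep Y Z (f g : shom Y Z) :
  (forall M (e : shom Y Z -> M), eval_point e -> e f = e g) -> f = g.
Proof.
by move=> fg; apply: shom_ext => y; exact: (fg Z _ (EvalPoint Z y)).
Qed.

Definition zero_of M : M := sval (cid (zero_ex M)).

Lemma zero_ofP M : is_zero (zero_of M).
Proof. exact: svalP (cid (zero_ex M)). Qed.

Definition shom0 Y Z : shom Y Z := SHom (@zero_shom Y Z _ (zero_ofP Z)).

Lemma eval_point_zero Y Z M (e : shom Y Z -> M) :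
  eval_point e -> is_zero (e (shom0 Y Z)).
Proof. by case=> y; exact: zero_ofP. Qed.

Definition hom_wmon Y Z : wmon Idx :=
  init_wmon infI (@eval_point_sep Y Z) (@eval_point_zero Y Z).

(** Strength of [Z] gives the sums at each [y], and [pointwise_sum_shom] makes the resulting
    function an element of the hom. [hom_ftotal] follows the same pattern. *)
Lemma hom_strong Y Z : is_strong Z -> is_strong (hom_wmon Y Z).
Proof.
move=> sZ; apply: init_strong => [M e [y] //|x a P xa].
have ex y : exists b,
    sums Z (fun i : {i | P i} => (x (sval i) : shom Y Z) y) b.
  have [sub _ _] := sZ; exact: (sub (fam_map _ x) _ P (xa Z _ (EvalPoint Z y))).
have [b xb] := choice ex.
exists (SHom (@pointwise_sum_shom Y Z _ _ b (or_introl sZ) xb)).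
by move=> M e [y]; exact: xb.
Qed.

Lemma hom_ftotal Y Z : is_ftotal Z -> is_ftotal (hom_wmon Y Z).
Proof.
move=> tZ; apply: init_ftotal => x fx.
have ex y : exists b, sums Z (fun i => (x i : shom Y Z) y) b.
  have [//|b xb] := tZ (fam_map (fun f : shom Y Z => f y) x).
  by exists b; apply/(SsumP (fam_map (fun f : shom Y Z => f y) x)).
have [b xb] := choice ex.
have fx' := (finite_type _).1 fx.
exists (SHom (@pointwise_sum_shom Y Z _ _ b (or_intror (conj tZ fx')) xb)).
move=> M e [y].
by apply/(SsumP (fam_map (fun f : shom Y Z => f y) x)); exact: xb.
Qed.

(** Negation on [Z] is itself a homomorphism, so composing with it stays inside the hom. *)
Lemma hom_sgroup Y Z : is_sgroup Z -> is_sgroup (hom_wmon Y Z).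
Proof.
move=> [tZ [n n1 n2]]; split; first exact: hom_ftotal.
have [] : is_neg (fun f : hom_wmon Y Z => shom_comp (SHom n2) f).
  apply: init_neg => M e [y]; exists n => //.
by exists (fun f : hom_wmon Y Z => shom_comp (SHom n2) f).
Qed.

End InternalHom.

(** * Free objects *)

(** Infinitary formal sums. The fields of an [ifamily] are separate arguments of [Sum], so that the
    induction principle reaches every subterm. *)
Inductive term (Idx G : Type) :=
| Gen of G
| Sum (A : set Idx) (cA : countable A) (x : A -> term Idx G).

(** A relation, because a formal sum may have no value in [M]. *)
Fixpoint term_eval (Idx G : Type) (M : wmon Idx) (f : G -> M)
    (t : term Idx G) : M -> Prop :=
  match t with
  | Gen g => fun a => f g = a
  | Sum A cA x => fun a =>
      exists2 y : A -> M, forall i, term_eval f (x i) (y i) &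
        Ssum (IFamily cA y) = Some a
  end.

Lemma term_eval_fun (Idx G : Type) (M : wmon Idx) (f : G -> M) t a b :
  term_eval f t a -> term_eval f t b -> a = b.
Proof.
elim: t a b => [g|A cA x IH] a b /=; first by move=> <- <-.
move=> [y xy ya] [y' xy' ya']; have e : y = y'.
  by apply/funext => i; exact: IH (xy i) (xy' i).
by move: ya; rewrite e ya' => -[].
Qed.

(* The closure of the generators under defined sums inside the product of all
   models in [K].  The product itself is too large to be a carrier, so an
   element is given by a term, up to equality of its values. *)
Section Free.
Context (Idx : Type) (infI : infinite_set [set: Idx]) (G : Type).
Context (K : forall M : wmon Idx, (G -> M) -> Prop).

Definition term_good (t : term Idx G) : Prop :=
  forall (M : wmon Idx) (f : G -> M), K f -> exists a, term_eval f t a.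

Definition term_eq (t t' : term Idx G) : Prop :=
  forall (M : wmon Idx) (f : G -> M), K f ->
  forall a, term_eval f t a <-> term_eval f t' a.

Lemma term_eq_ext t t' : term_eq t t' -> term_eq t = term_eq t'.
Proof.
move=> e; apply/funext => u; apply/propext.
by split=> h M f k a; rewrite -(h M f k) e.
Qed.

(** A quotient whose classes are predicates on terms. The models are quantified over only inside
    [Prop], which keeps the carrier small. *)
Definition free_car : Type :=
  {c : term Idx G -> Prop | exists2 t, term_good t & c = term_eq t}.

Definition rep (c : free_car) : term Idx G := s2val (cid2 (svalP c)).

Lemma rep_good c : term_good (rep c).
Proof. exact: s2valP (cid2 (svalP c)). Qed.

Lemma repE c : sval c = term_eq (rep c).
Proof. exact: s2valP' (cid2 (svalP c)). Qed.

Definition cls t (tg : term_good t) : free_car :=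
  exist _ (term_eq t) (ex_intro2 _ _ t tg erefl).

Lemma rep_cls t (tg : term_good t) : term_eq t (rep (cls tg)).
Proof. by have /= -> := repE (cls tg). Qed.

Lemma cls_rep c : c = cls (rep_good c).
Proof. by case: c (repE c) (rep_good c) => c p /= e g; exact: eq_exist. Qed.

(** These are the projections of the product, expressed through the chosen representatives. *)
Definition free_point (M : wmon Idx) (e : free_car -> M) : Prop :=
  exists2 f : G -> M, K f & forall c, term_eval f (rep c) (e c).

Lemma free_point_cls (M : wmon Idx) (f : G -> M) (e : free_car -> M) :
    K f -> (forall c, term_eval f (rep c) (e c)) ->
  forall t (tg : term_good t), term_eval f t (e (cls tg)).
Proof. by move=> k fe t tg; apply/(rep_cls tg k). Qed.

Lemma free_sep a b :
  (forall (M : wmon Idx) (e : free_car -> M), free_point e -> e a = e b) ->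
  a = b.
Proof.
move=> ab; suff : sval a = sval b.
  by case: a b {ab} => [a p] [b q] /= e; exact: eq_exist.
rewrite !repE; apply: term_eq_ext => M f k v.
have [e fe] := choice (fun c => rep_good c k).
have {}ab : e a = e b by apply: ab; exists f.
by split=> fv; rewrite (term_eval_fun fv (fe _)) ?ab // -ab.
Qed.

Lemma zero_term_good :
  term_good (Sum (countable0 Idx) (fun i => False_rect _ (set_mem (valP i)))).
Proof.
move=> M f k; have [z z0] := zero_ex M.
exists z; exists (fun=> z) => [i|]; first by case: (set_mem (valP i)).
by apply/SsumP; apply: (sums_void _ z0) => i; case: (set_mem (valP i)).
Qed.

Lemma free_zero (M : wmon Idx) (e : free_car -> M) :
  free_point e -> is_zero (e (cls zero_term_good)).
Proof.
move=> [f k /(free_point_cls k)/(_ _ zero_term_good)[y _ /SsumP yz]].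
apply: (sums_bij_imp (phi := fun i => False_rect _ (set_mem (valP i))) yz).
  by exists (@of_void _) => [i|[]]; case: (set_mem (valP i)).
by move=> i; case: (set_mem (valP i)).
Qed.

Definition free_wmon : wmon Idx := init_wmon infI free_sep free_zero.

Lemma free_point_shom (M : wmon Idx) (e : free_wmon -> M) :
  free_point e -> is_shom e.
Proof. exact: init_point. Qed.

Lemma gen_good g : term_good (Gen Idx g).
Proof. by move=> M f k; exists (f g). Qed.

Definition gen (g : G) : free_wmon := cls (gen_good g).

Lemma point_gen (M : wmon Idx) (e : free_wmon -> M) :
  free_point e -> exists2 f : G -> M, K f & forall g, e (gen g) = f g.
Proof.
move=> [f k /(free_point_cls k) fe]; exists f => // g.
by have /= -> := fe _ (gen_good g).
Qed.

(** The existence half of the universal property; [free_hom_eq] is the uniqueness half. *)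
Lemma free_ext (M : wmon Idx) (f : G -> M) :
  K f -> exists h : shom free_wmon M, forall g, h (gen g) = f g.
Proof.
move=> k; have [e fe] := choice (fun c => rep_good c k).
have p : free_point e by exists f; [|exact: fe].
exists (SHom (free_point_shom p)) => g /=.
by have /= -> := free_point_cls k fe (gen_good g).
Qed.

Lemma free_sumP (x : ifamily Idx free_wmon) a :
  (forall (M : wmon Idx) (e : free_wmon -> M), free_point e ->
    Ssum (fam_map e x) = Some (e a)) -> Ssum x = Some a.
Proof. by move=> H; apply/(init_sumP free_sep x a) => M e; exact: H. Qed.

(** Closure under pointwise sums: once the family has a sum at every point, the formal sum of the
    representatives is a good term, and its class is the common value. *)
Lemma free_sum_ex (x : ifamily Idx free_wmon) :
  (forall (M : wmon Idx) (e : free_wmon -> M), free_point e ->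
    exists a, Ssum (fam_map e x) = Some a) ->
  exists a, forall (M : wmon Idx) (e : free_wmon -> M), free_point e ->
    Ssum (fam_map e x) = Some (e a).
Proof.
move=> H.
have tg : term_good (Sum (fidx_countable x) (fun i => rep (x i))).
  move=> M f k; have [e fe] := choice (fun c => rep_good c k).
  have [|a xa] := H M e; first by exists f.
  by exists a; exists (fun i => e (x i)).
exists (cls tg) => M e p; have [a xa] := H M e p.
have [f k fe] := p.
have /= [y xy yb] := free_point_cls k fe tg.
rewrite -yb; congr Ssum; congr IFamily; apply/funext => i.
exact: term_eval_fun (fe _) (xy i).
Qed.

(** Induction on a representing term: every element is reached from the generators by defined
    sums. *)
Lemma free_ind (Q : free_wmon -> Prop) :
    (forall g, Q (gen g)) ->
    (forall x a, Ssum x = Some a -> (forall i, Q (x i)) -> Q a) ->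
  forall c, Q c.
Proof.
move=> Qg QS c; rewrite (cls_rep c); move: (rep c) (rep_good c).
elim=> [g|A cA x IH] tg.
  by rewrite (_ : cls tg = gen g) //; exact: eq_exist.
(* A formal sum has a value only if its entries do, so subterms of good terms are good. *)
have xg i : term_good (x i).
  by move=> M f /(tg M f)[a [y xy _]]; exists (y i); exact: xy.
apply: (QS (IFamily cA (fun i => cls (xg i) : free_wmon))); last first.
  by move=> i; exact: IH.
apply: free_sumP => M e [f k fe]; have /= [y xy <-] := free_point_cls k fe tg.
congr Ssum; congr IFamily; apply/funext => i.
by apply: term_eval_fun (xy i); exact: free_point_cls.
Qed.

Lemma free_hom_eq (M : wmon Idx) (h h' : shom free_wmon M) :
  (forall g, h (gen g) = h' (gen g)) -> h = h'.
Proof.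
move=> hh; apply: shom_ext; apply: free_ind => // x a xa IH.
have := shomP h xa; have := shomP h' xa.
rewrite (_ : fam_map h x = fam_map h' x) => [->[]//|].
by congr IFamily; exact/funext.
Qed.

(** Each model sums the subfamily because it is strong, and [free_sum_ex] gathers these values into
    one element. *)
Lemma free_strong : (forall (M : wmon Idx) (f : G -> M), K f -> is_strong M) ->
  is_strong free_wmon.
Proof.
move=> KM.
have sM (M : wmon Idx) (e : free_car -> M) : free_point e -> is_strong M.
  by move=> [f /KM].
apply: init_strong => // x a P xa.
have [y ry] := represents_ex infI (fun i : {i | P i} => x (sval i))
  (@countable_sub _ _ x P).
have [|b yb] := free_sum_ex (x := y).
  move=> M e p; have [sub _ _] := sM M e p.
  have [b [y' ry' y'b]] := sub (fam_map e x) _ P (xa M e p).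
  exists b; rewrite -y'b.
  apply: Ssum_ident; apply: represents_trans ry'; exact: (represents_map e ry).
exists b => M e p; exists (fam_map e y); last exact: yb.
exact: (represents_map e ry).
Qed.

Lemma free_ftotal : (forall (M : wmon Idx) (f : G -> M), K f -> is_ftotal M) ->
  is_ftotal free_wmon.
Proof.
move=> KM; apply: init_ftotal => x fx; apply: free_sum_ex => M e [f /KM tM _].
exact: tM.
Qed.

End Free.

(** * Reflections and tensor products *)

Section Reflections.
Context (Idx : Type).
Implicit Types (P Q : wmon Idx -> Prop).

(** A universal arrow out of a single object: [left_adjoint_ex] assembles such arrows into an
    adjunction, and [adj_reflection] recovers them from one. *)
Definition reflection P (X A : wmon Idx) (eta : shom X A) : Prop :=
  forall Z, P Z -> forall f : shom X Z,
    exists! h : shom A Z, forall x, h (eta x) = f x.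

Lemma reflection_eq P X A (eta : shom X A) Z (h h' : shom A Z) :
    reflection P eta -> P Z -> (forall x, h (eta x) = h' (eta x)) ->
  forall a, h a = h' a.
Proof.
move=> r PZ hh a; have [k [_ u]] := r Z PZ (shom_comp h eta).
by rewrite -(u h (fun=> erefl)) -(u h' (fun x => esym (hh x))).
Qed.

Definition reflect_lift P X A (eta : shom X A) (r : reflection P eta) Z
  (PZ : P Z) (f : shom X Z) : shom A Z := sval (cid (r Z PZ f)).

Lemma reflect_liftE P X A (eta : shom X A) (r : reflection P eta) Z
    (PZ : P Z) (f : shom X Z) x : reflect_lift r PZ f (eta x) = f x.
Proof. exact: (svalP (cid (r Z PZ f))).1. Qed.

Lemma left_adjoint_ex P Q (PQ : forall M, P M -> Q M) :
    (forall X : sobj Q,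
      exists (A : sobj P) (eta : shom X A), reflection P eta) ->
  inhabited (left_adjoint (sigma_incl PQ)).
Proof.
move=> ex; pose A (X : sobj Q) : sobj P := sval (cid (ex X)).
pose eta (X : sobj Q) : shom X (A X) := sval (cid (svalP (cid (ex X)))).
have r X : reflection P (eta X) := svalP (cid (svalP (cid (ex X)))).
pose lift (X : sobj Q) (Z : sobj P) (f : shom X Z) : shom (A X) Z :=
  reflect_lift (r X) (sobj_prop Z) f.
have liftE (X : sobj Q) (Z : sobj P) (f : shom X Z) x :
    lift X Z f (eta X x) = f x.
  exact: reflect_liftE.
have eqA (X : sobj Q) (Z : sobj P) (h h' : shom (A X) Z) :
    (forall x, h (eta X x) = h' (eta X x)) -> h = h'.
  by move=> hh; apply/shom_ext/(reflection_eq (r X) (sobj_prop Z)).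
clearbody lift.
pose F_ (X Y : sobj Q) (f : shom X Y) := lift X (A Y) (shom_comp (eta Y) f).
have F_E X Y f x : F_ X Y f (eta X x) = eta Y (f x) by rewrite /F_ liftE.
have F1 X : F_ X X (shom_id X) = shom_id (A X).
  by apply: eqA => x; rewrite liftE.
have FM (X Y Z : sobj Q) (g : shom Y Z) (f : shom X Y) :
    F_ X Z (shom_comp g f) = shom_comp (F_ Y Z g) (F_ X Y f).
  by apply: eqA => x /=; rewrite ?(liftE, F_E).
pose F := @Functor (sigma_cat Q) (sigma_cat P) A F_ F1 FM.
(* The counit is the lift of the identity, and every law is tested on the image of the unit. *)
constructor; apply: (@LeftAdjoint _ _ (sigma_incl PQ) F eta
  (fun Z => lift (sigma_incl PQ Z) Z (shom_id _))).
- by move=> X Y f; apply: shom_ext => x /=; rewrite liftE.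
- by move=> Z W f; apply: eqA => x /=; rewrite ?(liftE, F_E).
- by move=> X; apply: eqA => x /=; rewrite ?(liftE, F_E).
- by move=> Z; apply: shom_ext => x /=; rewrite liftE.
Qed.

Section Adjoint.
Context P Q (PQ : forall M, P M -> Q M) (F : left_adjoint (sigma_incl PQ)).

Definition adj_unit (X : sobj Q) : shom X (F X : sobj P) := aunit F X.

(** The final result concerns arbitrary left adjoints, so the universal arrow is derived from the
    adjunction data. A factorisation must be the counit after the image of [f] under [F], by
    naturality of the counit and [triangle_l]; that this is one follows from naturality of the unit
    and [triangle_r]. *)
Lemma adj_reflection (X : sobj Q) : reflection P (adj_unit X).
Proof.
move=> Z PZ f; pose Z' : sobj P := SObj PZ.
pose eps : shom (F (sigma_incl PQ Z') : sobj P) Z := acounit F Z'.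
have lift (h : shom (F X : sobj P) Z) (g : shom X Z) :
    (forall x, h (adj_unit X x) = g x) ->
    h = shom_comp eps (fmap F (g : @hom (sigma_cat Q) X (sigma_incl PQ Z'))).
  move=> /(shom_ext (f := shom_comp h (adj_unit X))) <-.
  have -> := @fmapM _ _ F X (sigma_incl PQ (F X)) (sigma_incl PQ Z') h
    (aunit F X).
  have /= e := @acounit_nat _ _ _ F (F X) Z' h.
  have /= t := @triangle_l _ _ _ F X.
  apply: shom_ext => a /=.
  have := congr1 (fun k : shom _ _ => k a) t => /= {t} t.
  have := congr1 (fun k : shom _ _ => k (fmap F (aunit F X) a)) e => /= {}e.
  by rewrite -e t.
exists (shom_comp eps (fmap F (f : @hom (sigma_cat Q) X (sigma_incl PQ Z')))).
split=> [x|h hf] /=; last exact/esym/lift.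
have n := @aunit_nat _ _ _ F X (sigma_incl PQ Z') f.
have := congr1 (fun k : shom _ _ => k x) n => /= {}n.
rewrite /adj_unit -[X in eps X]n.
exact: (congr1 (fun k : shom _ _ => k (f x)) (@triangle_r _ _ _ F Z')).
Qed.

Lemma fmap_unit (X Y : sobj Q) (f : shom X Y) x :
  (fmap F (f : @hom (sigma_cat Q) X Y) : shom _ _) (adj_unit X x)
  = adj_unit Y (f x).
Proof. exact: esym (congr1 (fun k : shom _ _ => k x) (aunit_nat F f)). Qed.

End Adjoint.
End Reflections.

(** * Uniqueness of negatives *)

Section Negation.
Context (Idx : Type) (infI : infinite_set [set: Idx]).
Implicit Types M N : wmon Idx.

Definition pair_fam (X : Type) (a b : X) : bool -> X :=
  fun i => if i then a else b.

Lemma sums_ex M T (g : T -> M) : is_ftotal M -> finite_set [set: T] ->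
  exists a, sums M g a.
Proof.
move=> tM fT; have [x gx] := represents_ex infI g (finite_set_countable fT).
have [h [[k _ hK] _]] := gx.
have [|a xa] := tM x; last by exists a, x.
by apply/finite_type; apply: finite_inj (can_inj hK) fT.
Qed.

Definition triple_fam (X : Type) (a b c : X) : option bool -> X :=
  fun i => if i is Some j then pair_fam b c j else a.

(** Bracketing [a] with [b] turns the triple into the pair of [z] and [c], from which the zero drops
    out. *)
Lemma sums_triple M (a b c z s : M) : is_zero z ->
  sums M (pair_fam a b) z -> sums M (triple_fam a b c) s -> s = c.
Proof.
move=> z0 ab abc.
pose T (j : bool) : Type := if j then bool else unit.
pose g (j : bool) : T j -> M :=
  if j is true return T j -> M then pair_fam a b else fun=> c.
have zc : sums M (pair_fam z c) s.
  apply: (sums_bracketing infI (T := T) (g := g)).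
  - exact: countableP.
  - by case; exact: finite_finset.
  - by case=> //; exact: Ssum_singleton.
  pose h (i : option bool) : {j : bool & T j} :=
    match i with
    | None => existT T true true
    | Some true => existT T true false
    | Some false => existT T false tt
    end.
  apply: (sums_bij_imp abc (phi := h)); last by case=> [[]|].
  exists (fun p => (if projT1 p as j return T j -> option bool
    then fun t => if t then None else Some true
    else fun=> Some false) (projT2 p)) => [[[]|]|[[] []]] //.
have zc' : sums M (fun t : {j | j = false} => pair_fam z c (sval t)) s.
  by apply: (sums_drop_zeros infI z0 _ zc) => -[].
apply: (sums_fun zc'); apply: (sums_unit (t0 := exist _ false erefl)) => //.
by move=> [j p]; exact: eq_exist.
Qed.

(** By finite totality [a], [b], [c] have a sum. It equals [c] if [a] is bracketed with [b], and [b]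
    if [a] is bracketed with [c]. *)
Lemma neg_unique M (a b c z : M) : is_ftotal M -> is_zero z ->
  sums M (pair_fam a b) z -> sums M (pair_fam a c) z -> b = c.
Proof.
move=> tM z0 ab ac.
have [s abc] := sums_ex (triple_fam a b c) tM finite_finset.
rewrite -(sums_triple z0 ab abc); apply/esym/(sums_triple z0 ac).
apply: (sums_bij_imp abc (phi := omap negb)); last by case=> [[]|].
by exists (omap negb) => -[[]|].
Qed.

(** Both sides are opposites of [f x]. Taking the identity for [f] shows that any two negations
    agree. *)
Lemma is_neg_unique M N (f : M -> N) (m : M -> M) (n : N -> N) x :
  is_ftotal N -> is_shom f -> is_neg m -> is_neg n -> f (m x) = n (f x).
Proof.
move=> tN hf [mP _] [nP _]; have [z z0 nz] := nP (f x).
have [z' z0' mz] := mP x.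
apply: (@neg_unique N (f x) _ _ z) => //.
have <- : f z' = z.
  by apply: zero_unique z0; apply: sums_eq (shom_sums hf z0') => -[].
by apply: sums_eq (shom_sums hf mz) => -[].
Qed.

Lemma is_negK M (n : M -> M) x : is_ftotal M -> is_neg n -> n (n x) = x.
Proof.
move=> tM [nP _]; have [z z0 nz] := nP x; have [z' z0' nnz] := nP (n x).
move: nnz; rewrite (zero_unique z0' z0) => nnz.
apply: (@neg_unique M (n x) _ _ z) => //.
apply: (sums_bij_imp nz (phi := negb)); last by case.
by exists negb => -[].
Qed.

End Negation.

(** * Existence of reflections and tensor products *)

Section Existence.
Context (Idx : Type) (infI : infinite_set [set: Idx]).
Implicit Types (M : wmon Idx) (P Q : wmon Idx -> Prop).

(** This is how relations imposed through [K] become laws of the free object: a sum of generators is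
    tested in the models. *)
Lemma gen_shom G (K : forall M, (G -> M) -> Prop) (X : wmon Idx) (u : X -> G) :
    (forall M (f : G -> M), K M f -> is_shom (f \o u)) ->
  is_shom (fun x => gen infI K (u x)).
Proof.
move=> Ku x a xa; apply: free_sumP => M e /point_gen[f k fe].
rewrite fe -(Ku _ _ k _ _ xa); congr Ssum; congr IFamily.
by apply/funext => i; exact: fe.
Qed.

Section Reflection.
Context P (X : wmon Idx).

Definition Pshom M (f : X -> M) : Prop := P M /\ is_shom f.

(** The hypothesis isolates what depends on [P]. Strength and finite totality pass from the models
    to the free object; for groups opposites have to be generated as well, hence the separate
    construction below. *)
Lemma reflection_ex : P (free_wmon infI Pshom) ->
  exists (A : sobj P) (eta : shom X A), reflection P eta.
Proof.
move=> PF; exists (SObj PF).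
exists (SHom (@gen_shom _ Pshom X id (fun M f k => proj2 k))).
move=> Z PZ f; have [//|h hf] := @free_ext _ infI _ Pshom Z f.
  by split=> //; exact: shomP.
by exists h; split=> // k kf; apply: free_hom_eq => x; rewrite hf -kf.
Qed.

End Reflection.

Lemma strong_reflection (X : wmon Idx) :
  exists (A : sobj (@is_strong Idx)) (eta : shom X A),
    reflection (@is_strong Idx) eta.
Proof. by apply: reflection_ex; apply: free_strong => M f []. Qed.

Lemma ftotal_reflection (X : wmon Idx) :
  exists (A : sobj (@is_ftotal Idx)) (eta : shom X A),
    reflection (@is_ftotal Idx) eta.
Proof. by apply: reflection_ex; apply: free_ftotal => M f []. Qed.

Section Group.
Context (X : wmon Idx).

(* [(x, false)] generates the opposite of [(x, true)]. *)
Definition group_model M (f : X * bool -> M) : Prop :=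
  [/\ is_sgroup M, is_shom (fun x => f (x, true))
    & forall n, is_neg n -> forall x b, f (x, ~~ b) = n (f (x, b))].

(** Opposites of generators are generators, and a sum of opposites is the opposite of the sum
    because negation in each model is a homomorphism. Induction then reaches every element. *)
Lemma free_group : is_sgroup (free_wmon infI group_model).
Proof.
have tF : is_ftotal (free_wmon infI group_model).
  by apply: free_ftotal => M f [[]].
split=> //.
(* Opposites start as a relation, since [free_ind] proves propositions; choice turns the relation
   into a function afterwards. *)
pose opp (c c' : free_wmon infI group_model) := forall M e,
  @free_point _ _ group_model M e -> forall n, is_neg n -> e c' = n (e c).
have ex c : exists c', opp c c'.
  elim/free_ind: c => [[x b]|x a xa /choice[y xy]].
    exists (gen infI group_model (x, ~~ b)).
    move=> M e /point_gen[f [_ _ fn] fe] n nn.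
    by rewrite !fe; exact: fn.
  have y' : exists a', forall M (e : free_wmon infI group_model -> M),
      free_point e ->
      Ssum (fam_map e (IFamily (fidx_countable x) y)) = Some (e a').
    apply: free_sum_ex => M e p; have [f [sM _ _] _] := p.
    have [_ [n n1 n2]] := sM; exists (n (e a)).
    rewrite -(n2 _ _ (free_point_shom p xa)); congr Ssum; congr IFamily.
    by apply/funext => i; exact: xy.
  have [a' ya'] := y'; exists a' => M e p n [n1 n2].
  apply: Some_inj; rewrite -(ya' M e p) -(n2 _ _ (free_point_shom p xa)).
  by congr Ssum; congr IFamily; apply/funext => i; exact: xy.
have [o oP] := choice ex; suff [] : is_neg o by exists o.
apply: init_neg => M e p; have [f [[_ [n n1 n2]] _ _] _] := p.
by exists n => // c; exact: oP.
Qed.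

Lemma group_reflection :
  exists (A : sobj (@is_sgroup Idx)) (eta : shom X A),
    reflection (@is_sgroup Idx) eta.
Proof.
exists (SObj free_group).
have us : is_shom (fun x => gen infI group_model (x, true)).
  by apply: gen_shom => M f [].
exists (SHom us) => Z sZ f; have [tZ [n n1 n2]] := sZ.
have nn : is_neg n by [].
pose g (p : X * bool) := if p.2 then f p.1 else n (f p.1).
have gm : group_model g.
  split=> //; first exact: shomP.
  move=> m mm x b.
  (* A model must satisfy the law for every negation [m], and each of them agrees with [n]. *)
  have <- : n (g (x, b)) = m (g (x, b)).
    exact: (is_neg_unique infI _ tZ (@is_shom_id _ Z) nn mm).
  by case: b; rewrite /g //= (is_negK infI).
have [h hg] := free_ext infI gm.
exists h; split=> [x|k kf]; first exact: hg.
(* Only the generators [(x, true)] come from the unit. The others are their opposites, which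
   homomorphisms preserve. *)
apply: free_hom_eq => -[x [|]]; first by rewrite hg /g /= -kf.
have [_ [o o1 o2]] := free_group; have oo : is_neg o by [].
have e : gen infI group_model (x, false) = o (gen infI group_model (x, true)).
  apply: free_sep => M e p; have [g' [sM _ gn] ge] := point_gen p.
  have [tM [m m1 m2]] := sM; have mm : is_neg m by [].
  rewrite (is_neg_unique infI _ tM (free_point_shom p) oo mm) !ge.
  exact: gn mm x true.
rewrite e !(is_neg_unique infI _ tZ (shomP _) oo nn); congr n.
by rewrite hg /g /= -kf.
Qed.

End Group.

Section Tensor.
Context (X Y : wmon Idx).

Definition bilinear_model M (f : X * Y -> M) : Prop :=
  sbilinear (fun x y => f (x, y)).

Definition tensor_univ P (T : wmon Idx) (p : X -> Y -> T) : Prop :=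
  forall Z, P Z -> forall f : X -> Y -> Z, sbilinear f ->
    exists! h : shom T Z, forall x y, h (p x y) = f x y.

Lemma weak_tensor : exists (T : sobj (@is_weak Idx)) (p : X -> Y -> T),
  sbilinear p /\ tensor_univ (@is_weak Idx) p.
Proof.
exists (@SObj _ (@is_weak Idx) (free_wmon infI bilinear_model) Logic.I).
exists (fun x y => gen infI bilinear_model (x, y)); split.
  split=> [x|y].
    by apply: (gen_shom (u := fun y => (x, y))) => M f [+ _]; apply.
  by apply: (gen_shom (u := fun x => (x, y))) => M f [_]; apply.
move=> Z _ f fb; pose g p := f p.1 p.2.
have [h hg] := @free_ext _ infI _ bilinear_model Z g fb.
exists h; split=> [x y|k kf]; first exact: hg.
by apply: free_hom_eq => -[x y]; rewrite hg kf.
Qed.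

(** A bilinear function to an object of [P] factors through [T], since that object lies in [Q] too,
    and then through [eta]. *)
Lemma reflect_tensor P Q (PQ : forall M, P M -> Q M) (T A : wmon Idx)
    (p : X -> Y -> T) (eta : shom T A) :
    sbilinear p -> tensor_univ Q p -> reflection P eta ->
  sbilinear (fun x y => eta (p x y)) /\
  tensor_univ P (fun x y => eta (p x y)).
Proof.
move=> [p1 p2] pu r; split.
  by split=> [x|y]; [exact: (is_shom_comp eta (SHom (p1 x)))
                    |exact: (is_shom_comp eta (SHom (p2 y)))].
move=> Z PZ f fb; have [g [gf gu]] := pu Z (PQ _ PZ) f fb.
have [h [hg hu]] := r Z PZ g; exists h; split=> [x y|k kf].
  by rewrite hg gf.
by apply: hu => x; rewrite (gu (shom_comp k eta)).
Qed.

End Tensor.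

Lemma tensor_products_ex P :
    (forall X Y : sobj P, exists (T : sobj P) (p : X -> Y -> T),
      sbilinear p /\ tensor_univ P p) ->
  inhabited (tensor_products P).
Proof.
move=> ex; pose T (X Y : sobj P) : sobj P := sval (cid (ex X Y)).
pose p (X Y : sobj P) : X -> Y -> T X Y := sval (cid (svalP (cid (ex X Y)))).
have pP X Y : sbilinear (p X Y) /\ tensor_univ P (p X Y).
  exact: svalP (cid (svalP (cid (ex X Y)))).
constructor; apply: (@TensorProducts Idx P T p) => [X Y|X Y Z f fb].
  exact: (pP X Y).1.
exact: (pP X Y).2 Z (sobj_prop Z) f fb.
Qed.

Lemma reflect_tensor_products P Q (PQ : forall M, P M -> Q M) :
    (forall X : sobj Q,
      exists (A : sobj P) (eta : shom X A), reflection P eta) ->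
  inhabited (tensor_products Q) -> inhabited (tensor_products P).
Proof.
move=> R [T]; apply: tensor_products_ex => X Y.
pose X' := SObj (PQ _ (sobj_prop X)); pose Y' := SObj (PQ _ (sobj_prop Y)).
have [A [eta r]] := R (tob T X' Y').
exists A, (fun x y => eta (@pure _ _ T X' Y' x y)).
apply: (reflect_tensor PQ (p := @pure _ _ T X' Y')) => //.
  exact: pure_bilinear.
by move=> Z QZ f fb; exact: (@pure_univ _ _ T X' Y' (SObj QZ) f fb).
Qed.

End Existence.

(** * Monoidal structure *)

Section Curry.
Context (Idx : Type) (infI : infinite_set [set: Idx]).
Context (X Y Z : wmon Idx).

Lemma hom_SsumP (x : ifamily Idx (hom_wmon infI Y Z)) (h : hom_wmon infI Y Z) :
  Ssum x = Some h <->
  forall y, Ssum (fam_map (fun f : shom Y Z => f y) x)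
    = Some ((h : shom Y Z) y).
Proof.
split=> [/(init_sumP (@eval_point_sep _ Y Z)) xh y|xh].
  exact: xh _ _ (EvalPoint Z y).
by apply/(init_sumP (@eval_point_sep _ Y Z)) => M e [y]; exact: xh.
Qed.

(** Sums in the hom are tested at each [y], where the claim is linearity in the first argument;
    linearity in the second makes the values homomorphisms. *)
Lemma curry_shom (f : X -> Y -> Z) (fb : sbilinear f) :
  @is_shom _ X (hom_wmon infI Y Z) (fun x => SHom (fb.1 x)).
Proof. by move=> x a xa; apply/hom_SsumP => y; exact: fb.2 y x a xa. Qed.

Definition curry (f : X -> Y -> Z) (fb : sbilinear f) :
  shom X (hom_wmon infI Y Z) := SHom (curry_shom fb).

Lemma uncurry_bilinear (g : shom X (hom_wmon infI Y Z)) :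
  sbilinear (fun x y => (g x : shom Y Z) y).
Proof.
split=> [x|y x a xa]; first exact: shomP.
exact: (hom_SsumP _ _).1 (shomP g xa) y.
Qed.

End Curry.

Lemma sbilinear_flip (Idx : Type) (X Y Z : wmon Idx) (f : X -> Y -> Z) :
  sbilinear f -> sbilinear (fun y x => f x y).
Proof. by case. Qed.

Section TensorProduct.
Context (Idx : Type) (P : wmon Idx -> Prop) (T : tensor_products P).
Implicit Types (X Y Z W : sobj P).

(** [tob] with result type [sobj P], so that the coercion to the carrier applies without
    annotations. *)
Definition ten X Y : sobj P := tob T X Y.

Definition tpure X Y (x : X) (y : Y) : ten X Y := pure T x y.

Definition tpure_l X Y (x : X) : shom Y (ten X Y) :=
  SHom ((pure_bilinear T X Y).1 x).
Definition tpure_r X Y (y : Y) : shom X (ten X Y) :=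
  SHom ((pure_bilinear T X Y).2 y).

Lemma comp_tpure_bilinear X Y (Z : wmon Idx) (h : shom (ten X Y) Z) :
  sbilinear (fun x y => h (tpure x y)).
Proof.
by split=> [x|y]; [exact: is_shom_comp h (tpure_l Y x)
                  |exact: is_shom_comp h (tpure_r X y)].
Qed.

Lemma tpure_comp_bilinear (X' Y' : wmon Idx) X Y (f : shom X' X)
    (g : shom Y' Y) : sbilinear (fun x y => tpure (f x) (g y)).
Proof.
by split=> [x|y]; [exact: is_shom_comp (tpure_l _ (f x)) g
                  |exact: is_shom_comp (tpure_r _ (g y)) f].
Qed.

Definition tlift X Y Z (f : X -> Y -> Z) (fb : sbilinear f) :
  shom (ten X Y) Z := sval (cid (pure_univ T fb)).

Lemma tliftE X Y Z (f : X -> Y -> Z) (fb : sbilinear f) x y :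
  tlift fb (tpure x y) = f x y.
Proof. exact: (svalP (cid (pure_univ T fb))).1. Qed.

Lemma ten_eq X Y Z (h h' : shom (ten X Y) Z) :
  (forall x y, h (tpure x y) = h' (tpure x y)) -> forall t, h t = h' t.
Proof.
move=> hh t; have [k [_ u]] := pure_univ T (comp_tpure_bilinear h).
by rewrite -(u h) // -(u h') // => x y; rewrite hh.
Qed.

End TensorProduct.

Section TensorStructure.
Context (Idx : Type) (infI : infinite_set [set: Idx]) (P : wmon Idx -> Prop).
(** Besides tensor products, the construction asks two things of [P]: closure under internal homs
    ([homP]) and a unit that is free on [one] ([unP]). *)
Context (homP : forall Y Z, P Z -> P (hom_wmon infI Y Z)).
Context (T : tensor_products P) (un : sobj P) (one : un).
Context (unP : forall (Z : sobj P) (z : Z), exists! h : shom un Z, h one = z).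
Implicit Types (W X Y Z : sobj P).

Local Notation ten := (ten T).
Local Notation p := (tpure T).
Local Notation p_l := (tpure_l T).
Local Notation p_r := (tpure_r T).
Local Notation tlift := (tlift T).
Let ihom Y Z : sobj P := SObj (homP Y (sobj_prop Z)).

Let ten3_eq X Y Z W (h h' : shom (ten (ten X Y) Z) W) :
    (forall x y z, h (p (p x y) z) = h' (p (p x y) z)) ->
  forall t, h t = h' t.
Proof.
move=> hh; apply: ten_eq => t z.
apply: (ten_eq (h := shom_comp h (p_r _ z)) (h' := shom_comp h' (p_r _ z))).
by move=> x y; exact: hh.
Qed.

Let ten3r_eq X Y Z W (h h' : shom (ten X (ten Y Z)) W) :
    (forall x y z, h (p x (p y z)) = h' (p x (p y z))) ->
  forall t, h t = h' t.
Proof.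
move=> hh; apply: ten_eq => x.
apply: (ten_eq (h := shom_comp h (p_l _ x)) (h' := shom_comp h' (p_l _ x))).
exact: hh.
Qed.

Let ten4_eq X Y Z W (V : sobj P) (h h' : shom (ten (ten (ten X Y) Z) W) V) :
    (forall x y z w, h (p (p (p x y) z) w) = h' (p (p (p x y) z) w)) ->
  forall t, h t = h' t.
Proof.
move=> hh; apply: ten_eq => t w.
apply: (ten3_eq (h := shom_comp h (p_r _ w)) (h' := shom_comp h' (p_r _ w))).
by move=> x y z; exact: hh.
Qed.

Let un_eq Z (h h' : shom un Z) : h one = h' one -> forall u, h u = h' u.
Proof.
by move=> hh a; have [k [_ u]] := unP (h one); rewrite -(u h) // -(u h').
Qed.

Let tm X X' Y Y' (f : shom X X') (g : shom Y Y') :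
  shom (ten X Y) (ten X' Y') := tlift (tpure_comp_bilinear T f g).

Let tmE X X' Y Y' (f : shom X X') (g : shom Y Y') x y :
  tm f g (p x y) = p (f x) (g y).
Proof. exact: tliftE. Qed.

Let br X Y : shom (ten X Y) (ten Y X) :=
  tlift (sbilinear_flip (pure_bilinear T Y X)).

Let brE X Y x y : br X Y (p x y) = p y x.
Proof. exact: tliftE. Qed.

(** The associator comes from a trilinear function, but only bilinear ones lift. So [z] is first
    moved into an internal hom, [x] and [y] are lifted, and the uncurried result is lifted again. *)
Let assoc_pre X Y Z (x : X) (y : Y) : ihom Z (ten X (ten Y Z)) :=
  shom_comp (p_l _ x) (p_l Z y).

Let assoc_pre_bilinear X Y Z : sbilinear (@assoc_pre X Y Z).
Proof.
split=> [x|y] v a va; apply/hom_SsumP => z.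
  exact: (shomP (shom_comp (p_l _ x) (p_r Y z)) va).
exact: (shomP (p_r X (p y z)) va).
Qed.

Let asc X Y Z : shom (ten (ten X Y) Z) (ten X (ten Y Z)) :=
  tlift (uncurry_bilinear (tlift (@assoc_pre_bilinear X Y Z))).

Let ascE X Y Z x y z : asc X Y Z (p (p x y) z) = p x (p y z).
Proof. by rewrite /asc tliftE tliftE. Qed.

(** The inverse associator rotates cyclically: [x(yz)], [(yz)x], [y(zx)], [(zx)y], [z(xy)], [(xy)z].
    This avoids a second trilinear lift. *)
Let csa X Y Z : shom (ten X (ten Y Z)) (ten (ten X Y) Z) :=
  shom_comp (br Z (ten X Y)) (shom_comp (asc Z X Y) (shom_comp (br Y (ten Z X))
    (shom_comp (asc Y Z X) (br X (ten Y Z))))).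

Let csaE X Y Z x y z : csa X Y Z (p x (p y z)) = p (p x y) z.
Proof. by rewrite /csa /= !(brE, ascE). Qed.

(** Freeness of the unit gives a homomorphism to the endomorphisms of [X] that sends [one] to the
    identity; uncurried, it is the left unitor. *)
Let lu_curry X : shom un (ihom X X) :=
  sval (cid (unP (shom_id X : ihom X X))).

Let lu_curryE X : lu_curry X one = shom_id X.
Proof. exact: (svalP (cid (unP (shom_id X : ihom X X)))).1. Qed.

Let lu X : shom (ten un X) X := tlift (uncurry_bilinear (lu_curry X)).

Let luE X x : lu X (p one x) = x.
Proof. by rewrite /lu tliftE lu_curryE. Qed.

Let ru X : shom (ten X un) X := shom_comp (lu X) (br X un).

Let ruE X x : ru X (p x one) = x.
Proof. by rewrite /ru /= brE luE. Qed.

Let ul_eq X W (h h' : shom (ten un X) W) :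
  (forall x, h (p one x) = h' (p one x)) -> forall t, h t = h' t.
Proof.
move=> hh; apply: ten_eq => u x.
apply: (un_eq (h := shom_comp h (p_r _ x)) (h' := shom_comp h' (p_r _ x))).
exact: hh.
Qed.

Let ur_eq X W (h h' : shom (ten X un) W) :
  (forall x, h (p x one) = h' (p x one)) -> forall t, h t = h' t.
Proof.
move=> hh; apply: ten_eq => x.
apply: (un_eq (h := shom_comp h (p_l _ x)) (h' := shom_comp h' (p_l _ x))).
exact: hh.
Qed.

Let unit_mid_eq X Y W (h h' : shom (ten (ten X un) Y) W) :
    (forall x y, h (p (p x one) y) = h' (p (p x one) y)) ->
  forall t, h t = h' t.
Proof.
move=> hh; apply: ten_eq => t y.
apply: (ur_eq (h := shom_comp h (p_r _ y)) (h' := shom_comp h' (p_r _ y))).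
by move=> x; exact: hh.
Qed.

Let eval_bilinear Y Z : sbilinear (fun (f : ihom Y Z) y => (f : shom Y Z) y).
Proof. exact: uncurry_bilinear (shom_id (ihom Y Z)). Qed.

Let ev Y Z : shom (ten (ihom Y Z) Y) Z := tlift (@eval_bilinear Y Z).

Let evE Y Z (f : ihom Y Z) y : ev Y Z (p f y) = (f : shom Y Z) y.
Proof. exact: tliftE. Qed.

Let ev_univ X Y Z (f : shom (ten X Y) Z) :
  exists! g : shom X (ihom Y Z), shom_comp (ev Y Z) (tm g (shom_id Y)) = f.
Proof.
have fb := comp_tpure_bilinear f.
exists (curry infI fb : shom X (ihom Y Z)); split=> [|g gf].
  by apply/shom_ext/ten_eq => x y /=; rewrite tmE evE.
by apply: shom_ext => x; apply: shom_ext => y /=; rewrite -gf /= tmE evE.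
Qed.

Lemma tensor_structure_ex : inhabited (tensor_structure T un one).
Proof.
(* From here on only values on pure tensors are used, so the coherence laws reduce to rewriting. *)
clearbody tm br asc csa lu ru ev; constructor.
unshelve refine (let M : @sym_monoidal_closed (sigma_cat P) T un :=
  @SymMonoidalClosed (sigma_cat P) ten un tm _ _ asc lu ru br
   _ _ _ _ _ _ _ _ _ _ _ ihom ev _ in
  @TensorStructure _ _ T un one M _ _ _ _ _).
- by move=> X Y; apply/shom_ext/ten_eq => x y; rewrite tmE.
- move=> X X' X'' Y Y' Y'' f' f g' g; apply/shom_ext/ten_eq => x y /=.
  by rewrite !tmE.
- move=> X Y Z; exists (csa X Y Z); split; apply: shom_ext.
    by apply: ten3_eq => x y z /=; rewrite ascE csaE.
  by apply: ten3r_eq => x y z /=; rewrite csaE ascE.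
- move=> X; exists (p_l X one); split; apply: shom_ext.
    by apply: ul_eq => x /=; rewrite luE.
  exact: luE.
- move=> X; exists (p_r X one); split; apply: shom_ext.
    by apply: ur_eq => x /=; rewrite ruE.
  exact: ruE.
- move=> X X' Y Y' Z Z' f g h; apply/shom_ext/ten3_eq => x y z /=.
  by rewrite !(tmE, ascE).
- by move=> X X' f; apply/shom_ext/ul_eq => x /=; rewrite tmE !luE.
- move=> X X' f; apply/shom_ext/ur_eq => x.
  by rewrite /= tmE !ruE.
- move=> X X' Y Y' f g; apply/shom_ext/ten_eq => x y /=.
  by rewrite !(brE, tmE).
- move=> W X Y Z; apply/shom_ext/ten4_eq => w x y z /=.
  by rewrite !(tmE, ascE).
- move=> X Y; apply/shom_ext/unit_mid_eq => x y /=.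
  by rewrite !(tmE, ascE) /= luE ruE.
- move=> X Y Z; apply/shom_ext/ten3_eq => x y z /=.
  by rewrite !(tmE, ascE, brE).
- by move=> X Y; apply/shom_ext/ten_eq => x y /=; rewrite !brE.
- exact: ev_univ.
- exact: tmE.
- exact: ascE.
- exact: luE.
- exact: ruE.
- exact: brE.
Qed.

End TensorStructure.

(** Freeness of the unit passes along a left adjoint; for groups this is applied twice in
    succession, starting from the weak unit. *)
Lemma adj_unit_free (Idx : Type) (P Q : wmon Idx -> Prop)
    (PQ : forall M, P M -> Q M) (F : left_adjoint (sigma_incl PQ))
    (un : sobj Q) (one : un) :
    (forall (Z : sobj Q) (z : Z), exists! h : shom un Z, h one = z) ->
  forall (V : sobj P) (v : V),
    exists! h : shom (F un : sobj P) V, h (adj_unit F un one) = v.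
Proof.
move=> unQ V v; have [g [<- gu]] := unQ (SObj (PQ _ (sobj_prop V))) v.
have [h [hg hu]] := @adj_reflection _ _ _ _ F un V (sobj_prop V) g.
exists h; split=> [|k kv]; first exact: hg.
by apply: hu => x; rewrite (gu (shom_comp k (adj_unit F un))).
Qed.

(** * Strong monoidality of the left adjoints *)

Section StrongMonoidal.
Context (Idx : Type) (infI : infinite_set [set: Idx]).
Context (P Q : wmon Idx -> Prop) (PQ : forall M, P M -> Q M).
Context (homP : forall Y Z, P Z -> P (hom_wmon infI Y Z)).
Context (TQ : tensor_products Q) (TP : tensor_products P).
Context (F : left_adjoint (sigma_incl PQ)).
Context (un : sobj Q) (one : un).
Context (MC : tensor_structure TQ un one).
Context (MD : tensor_structure TP (F un) (adj_unit F un one)).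
Context (unQ : forall (Z : sobj Q) (z : Z), exists! h : shom un Z, h one = z).
Implicit Types (X Y Z : sobj Q) (U V W : sobj P).

Let FO X : sobj P := F X.
Let eta X : shom X (FO X) := adj_unit F X.
Let r X : reflection P (eta X) := @adj_reflection _ _ _ _ F X.

Let hom_eq X V (h h' : shom (FO X) V) :
  (forall x, h (eta X x) = h' (eta X x)) -> forall a, h a = h' a.
Proof. exact: (reflection_eq (@r X) (sobj_prop V)). Qed.

(** With one argument of the pure tensor fixed, both maps are homomorphisms in the other, so the
    uniqueness of reflections applies to each argument in turn. *)
Let ten_eta_eq X Y V (h h' : shom (ten TP (FO X) (FO Y)) V) :
    (forall x y, h (tpure TP (eta X x) (eta Y y))
                 = h' (tpure TP (eta X x) (eta Y y))) ->
  forall t, h t = h' t.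
Proof.
move=> hh; apply: ten_eq => a b; move: b.
apply: (hom_eq (h := shom_comp h (tpure_l _ _ a))
               (h' := shom_comp h' (tpure_l _ _ a))) => y; move: a.
apply: (hom_eq (h := shom_comp h (tpure_r _ _ (eta Y y)))
               (h' := shom_comp h' (tpure_r _ _ (eta Y y)))) => x.
exact: hh.
Qed.

Let ten3_eta_eq X Y Z V
    (h h' : shom (ten TP (ten TP (FO X) (FO Y)) (FO Z)) V) :
    (forall x y z, h (tpure TP (tpure TP (eta X x) (eta Y y)) (eta Z z))
                 = h' (tpure TP (tpure TP (eta X x) (eta Y y)) (eta Z z))) ->
  forall t, h t = h' t.
Proof.
move=> hh; apply: ten_eq => t c; move: c.
apply: (hom_eq (h := shom_comp h (tpure_l _ _ t))
               (h' := shom_comp h' (tpure_l _ _ t))) => z; move: t.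
apply: (ten_eta_eq (h := shom_comp h (tpure_r _ _ (eta Z z)))
               (h' := shom_comp h' (tpure_r _ _ (eta Z z)))) => x y.
exact: hh.
Qed.

(* A bilinear map is extended one argument at a time, through its curried forms
   with values in the internal homs [Y -> V] and [X -> V]. *)
Let ten_eta_lift X Y V (f : X -> Y -> V) : sbilinear f ->
  exists h : shom (ten TP (FO X) (FO Y)) V,
    forall x y, h (tpure TP (eta X x) (eta Y y)) = f x y.
Proof.
move=> fb.
pose g := reflect_lift (@r Y) (homP X (sobj_prop V))
  (curry infI (sbilinear_flip fb)).
have gb := uncurry_bilinear g.
pose k := reflect_lift (@r X) (homP (FO Y) (sobj_prop V))
  (curry infI (sbilinear_flip gb)).
exists (tlift TP (uncurry_bilinear k)) => x y.
by rewrite tliftE /k reflect_liftE /= /g reflect_liftE.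
Qed.

(** [Fm], [tmP], [asP] and [asQ] present categorical morphisms as Sigma-homomorphisms, so that their
    values on generators can be used for rewriting after the [change] steps below. *)
Let Fm X Y (f : shom X Y) : shom (FO X) (FO Y) :=
  fmap F (f : @hom (sigma_cat Q) X Y).

Let FmE X Y (f : shom X Y) x : Fm f (eta X x) = eta Y (f x).
Proof. exact: fmap_unit. Qed.

Let tmP V V' W W' (f : shom V V') (g : shom W W') :
  shom (ten TP V W) (ten TP V' W') := @tmap (sigma_cat P) _ _ MD V V' W W' f g.
Let tmPE V V' W W' (f : shom V V') (g : shom W W') v w :
  tmP f g (tpure TP v w) = tpure TP (f v) (g w).
Proof. exact: tmap_pure. Qed.

Let asP U V W : shom (ten TP (ten TP U V) W) (ten TP U (ten TP V W)) :=
  assoc MD U V W.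
Let asPE U V W u v w :
  asP U V W (tpure TP (tpure TP u v) w) = tpure TP u (tpure TP v w).
Proof. exact: assoc_pure. Qed.

Let asQ X Y Z : shom (ten TQ (ten TQ X Y) Z) (ten TQ X (ten TQ Y Z)) :=
  assoc MC X Y Z.
Let asQE X Y Z x y z :
  asQ X Y Z (tpure TQ (tpure TQ x y) z) = tpure TQ x (tpure TQ y z).
Proof. exact: assoc_pure. Qed.

Let un_eta_eq V (h h' : shom (FO un) V) :
  h (eta un one) = h' (eta un one) -> forall u, h u = h' u.
Proof.
move=> hh u; have [k [_ ku]] := adj_unit_free F unQ (h (eta un one)).
by rewrite -(ku h) // -(ku h').
Qed.

Let lu_eta_eq X V (h h' : shom (ten TP (FO un) (FO X)) V) :
    (forall x, h (tpure TP (eta un one) (eta X x))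
               = h' (tpure TP (eta un one) (eta X x))) ->
  forall t, h t = h' t.
Proof.
move=> hh; apply: ten_eq => u b; move: b.
apply: (hom_eq (h := shom_comp h (tpure_l _ _ u))
               (h' := shom_comp h' (tpure_l _ _ u))) => x; move: u.
apply: (un_eta_eq (h := shom_comp h (tpure_r _ _ (eta X x)))
                  (h' := shom_comp h' (tpure_r _ _ (eta X x)))).
exact: hh.
Qed.

Let ru_eta_eq X V (h h' : shom (ten TP (FO X) (FO un)) V) :
    (forall x, h (tpure TP (eta X x) (eta un one))
               = h' (tpure TP (eta X x) (eta un one))) ->
  forall t, h t = h' t.
Proof.
move=> hh; apply: ten_eq => a u; move: a.
apply: (hom_eq (h := shom_comp h (tpure_r _ _ u))
               (h' := shom_comp h' (tpure_r _ _ u))) => x; move: u.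
apply: (un_eta_eq (h := shom_comp h (tpure_l _ _ (eta X x)))
                  (h' := shom_comp h' (tpure_l _ _ (eta X x)))).
exact: hh.
Qed.

(** The comparison [mu] sends the tensor of [eta x] and [eta y] to [eta] of the tensor of [x] and
    [y], and [nu] goes back. The unit comparison is the identity, because the unit of the smaller
    category is [F un] itself. *)
Lemma strong_sym_monoidal_ex : inhabited (strong_sym_monoidal MC MD F).
Proof.
have mub X Y : sbilinear (fun x y => eta (ten TQ X Y) (tpure TQ x y)).
  exact: comp_tpure_bilinear.
pose mu X Y := sval (cid (ten_eta_lift (mub X Y))).
have muE X Y x y : mu X Y (tpure TP (eta X x) (eta Y y)) = eta _ (tpure TQ x y).
  exact: (svalP (cid (ten_eta_lift (mub X Y)))).
have nub X Y : sbilinear (fun x y => tpure TP (eta X x) (eta Y y)).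
  exact: tpure_comp_bilinear.
(* An object of [P] viewed in the larger category, where the universal property of [TQ] applies to
   it. *)
pose V_Q V : sobj Q := SObj (PQ (sobj_prop V)).
pose nu0 X Y : shom (ten TQ X Y) (V_Q (ten TP (FO X) (FO Y))) :=
  tlift TQ (nub X Y : sbilinear (Z := V_Q (ten TP (FO X) (FO Y))) _).
pose nu X Y := reflect_lift (@r (ten TQ X Y))
  (sobj_prop (ten TP (FO X) (FO Y))) (nu0 X Y).
have nuE X Y x y : nu X Y (eta _ (tpure TQ x y)) = tpure TP (eta X x) (eta Y y).
  by rewrite /nu reflect_liftE /nu0 tliftE.
clearbody mu nu.
constructor; apply: (@StrongSymMonoidal (sigma_cat Q) (sigma_cat P) TQ un MC
  TP (F un) MD F mu (shom_id (F un : sobj P))).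
- move=> X Y; exists (nu X Y); split; apply: shom_ext.
    by apply: ten_eta_eq => x y /=; rewrite muE nuE.
  apply: hom_eq.
  apply: (ten_eq (Z := V_Q _)
    (h := shom_comp (shom_comp (mu X Y) (nu X Y)) (eta (ten TQ X Y)))
    (h' := eta (ten TQ X Y))) => x y /=.
  by rewrite nuE muE.
- by exists (shom_id _); split; apply: shom_ext.
- move=> X X' Y Y' f g; apply/shom_ext/ten_eta_eq => x y.
  change (mu X' Y' (tmP (Fm f) (Fm g) (tpure TP (eta X x) (eta Y y)))
    = Fm (tmap MC f g : shom (ten TQ X Y) (ten TQ X' Y'))
        (mu X Y (tpure TP (eta X x) (eta Y y)))).
  by rewrite tmPE !FmE !muE FmE [in RHS]tmap_pure.
- move=> X Y Z; apply/shom_ext/ten3_eta_eq => x y z.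
  change (Fm (asQ X Y Z) (mu (ten TQ X Y) Z (tmP (mu X Y) (shom_id (FO Z))
      (tpure TP (tpure TP (eta X x) (eta Y y)) (eta Z z))))
    = mu X (ten TQ Y Z) (tmP (shom_id (FO X)) (mu Y Z) (asP (FO X) (FO Y) (FO Z)
      (tpure TP (tpure TP (eta X x) (eta Y y)) (eta Z z))))).
  by rewrite asPE !tmPE !muE FmE asQE.
- move=> X; apply/shom_ext/lu_eta_eq => x.
  change (Fm (lunit MC X : shom (ten TQ un X) X)
      (mu un X (tmP (shom_id (FO un)) (shom_id (FO X))
        (tpure TP (eta un one) (eta X x))))
    = (lunit MD (FO X) : shom _ _) (pure TP (eta un one) (eta X x))).
  by rewrite tmPE muE FmE !lunit_pure.
- move=> X; apply/shom_ext/ru_eta_eq => x.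
  change (Fm (runit MC X : shom (ten TQ X un) X)
      (mu X un (tmP (shom_id (FO X)) (shom_id (FO un))
        (tpure TP (eta X x) (eta un one))))
    = (runit MD (FO X) : shom _ _) (pure TP (eta X x) (eta un one))).
  by rewrite tmPE muE FmE !runit_pure.
- move=> X Y; apply/shom_ext/ten_eta_eq => x y.
  change (Fm (braid MC X Y : shom (ten TQ X Y) (ten TQ Y X))
      (mu X Y (tpure TP (eta X x) (eta Y y)))
    = mu Y X ((braid MD (FO X) (FO Y) : shom _ _)
        (pure TP (eta X x) (eta Y y)))).
  by rewrite muE FmE !braid_pure [RHS]muE.
Qed.

End StrongMonoidal.

(** * Freeness of the weak unit and the final assembly *)

Lemma shom_zero (Idx : Type) (M N : wmon Idx) (f : M -> N) z :
  is_shom f -> is_zero z -> is_zero (f z).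
Proof. by move=> hf z0; apply: sums_eq (shom_sums hf z0) => -[]. Qed.

(** A summable family in the unit has at most one entry [true], so its image has at most one nonzero
    entry. *)
Lemma Sw_unit_free (Idx : Type) (infI : infinite_set [set: Idx])
    (Z : sobj (@is_weak Idx)) (z : Z) :
  exists! h : shom (Sw_unit infI : sobj (@is_weak Idx)) Z, h (Sw_one infI) = z.
Proof.
pose h (b : unit_wmon infI) : Z := if b then z else zero_of Z.
have hP : is_shom h.
  move=> x b /unit_sumP xb; apply/SsumP.
  have cx := countable_type (fidx_countable x).
  have z0 := zero_ofP Z.
  case: b xb => [[i [xi ui]]|x0]; last first.
    by apply: (sums_zeros infI z0) => // i; rewrite /h /= x0.
  (* If [z] is itself zero, the image has no nonzero entry, so the one-point argument applies only
     in the other case. *)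
  have [zz|nz] := pselect (z = zero_of Z).
    rewrite /h zz; apply: (sums_zeros infI z0) => // j.
    by rewrite /=; case: (x j).
  apply: (sums_nonzero_out infI z0) => //.
  have p : h (x i) <> zero_of Z by rewrite /h xi.
  apply: (sums_unit (t0 := exist _ i p)); last by rewrite /= xi.
  move=> [j q]; apply: eq_exist; apply/esym/ui.
  by move: q; rewrite /= /h; case: (x j).
(* For uniqueness, [false] is the empty sum, so every homomorphism sends it to zero. *)
exists (SHom hP); split=> // k kz; apply: shom_ext => -[] //=.
apply: zero_unique (zero_ofP Z) _; apply: shom_zero (shomP k) _.
apply: unit_sums_toP; [exact: infI|exact: countableP|by case].
Qed.

Theorem theorem11 (Idx : Type) (infI : infinite_set [set: Idx]) :
  [/\ inhabited (tensor_products (@is_weak Idx)),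
      inhabited (tensor_products (@is_strong Idx)),
      inhabited (tensor_products (@is_ftotal Idx))
    & inhabited (tensor_products (@is_sgroup Idx))] /\
  [/\ inhabited (left_adjoint (Ss_Sw Idx)),
      inhabited (left_adjoint (Sft_Sw Idx))
    & inhabited (left_adjoint (Sg_Sft Idx))] /\
  forall (Tw : tensor_products (@is_weak Idx))
    (Ts : tensor_products (@is_strong Idx))
    (Tft : tensor_products (@is_ftotal Idx))
    (Tg : tensor_products (@is_sgroup Idx))
    (Fs : left_adjoint (Ss_Sw Idx))
    (Fft : left_adjoint (Sft_Sw Idx))
    (Fg : left_adjoint (Sg_Sft Idx)),
  let Iw := Sw_unit infI in
  let one_w := Sw_one infI in
  let one_s := aunit Fs Iw one_w in
  let one_ft := aunit Fft Iw one_w in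
  let one_g := aunit Fg (Fft Iw) one_ft in
  exists (Mw : tensor_structure Tw Iw one_w)
    (Ms : tensor_structure Ts (Fs Iw) one_s)
    (Mft : tensor_structure Tft (Fft Iw) one_ft)
    (Mg : tensor_structure Tg (Fg (Fft Iw)) one_g),
  [/\ inhabited (strong_sym_monoidal Mw Ms Fs),
      inhabited (strong_sym_monoidal Mw Mft Fft)
    & inhabited (strong_sym_monoidal Mft Mg Fg)].
Proof.
have Rs := fun X : sobj (@is_weak Idx) => strong_reflection infI X.
have Rft := fun X : sobj (@is_weak Idx) => ftotal_reflection infI X.
have Rg := fun X : sobj (@is_ftotal Idx) => group_reflection infI X.
have ETw : inhabited (tensor_products (@is_weak Idx)).
  by apply: tensor_products_ex => X Y; exact: weak_tensor.
have ETft := reflect_tensor_products (fun _ _ => Logic.I) Rft ETw.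
split; [split=> //|split; [split|]].
- exact: reflect_tensor_products (fun _ _ => Logic.I) Rs ETw.
(* Groups are reflected out of finitely total monoids, so their tensor product comes from that
   category and not from the weak one. *)
- exact: reflect_tensor_products (@sgroup_ftotal Idx) Rg ETft.
- exact: left_adjoint_ex.
- exact: left_adjoint_ex.
- exact: left_adjoint_ex.
move=> Tw Ts Tft Tg Fs Fft Fg Iw one_w one_s one_ft one_g.
have uw := Sw_unit_free infI.
have us := adj_unit_free Fs uw.
have uft := adj_unit_free Fft uw.
have ug := adj_unit_free Fg uft.
have hs := @hom_strong Idx infI.
have hft := @hom_ftotal Idx infI.
have hg := @hom_sgroup Idx infI.
have [Mw] := tensor_structure_ex (infI := infI) (fun _ _ _ => Logic.I) Tw uw.
have [Ms] := tensor_structure_ex hs Ts us.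
have [Mft] := tensor_structure_ex hft Tft uft.
have [Mg] := tensor_structure_ex hg Tg ug.
exists Mw, Ms, Mft, Mg; split.
- exact: (strong_sym_monoidal_ex hs Mw Ms uw).
- exact: (strong_sym_monoidal_ex hft Mw Mft uw).
- exact: (strong_sym_monoidal_ex hg Mft Mg uft).
Qed.
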